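(* Let $(\mathfrak g,[-,-],(-)^{[p]},R)$ be a restricted Rota-Baxter Lie algebra of weight $1$ over $\mathbf k$. Then the Rota-Baxter operator $R$ on the Hopf algebra $\mathrm U(\mathfrak g)$ extending $R$ descends to a Rota-Baxter operator on the restricted enveloping algebra $\mathrm u(\mathfrak g)=\mathrm U(\mathfrak g)/(x^p-x^{[p]}\mid x\in\mathfrak g)$. Furthermore, if $R$ is idempotent on $\mathfrak g$ and $\mathbf k$ is not of characteristic $2$, then this Rota-Baxter operator on $\mathrm u(\mathfrak g)$ is a Hopf algebra endomorphism of $\mathrm u(\mathfrak g)$.
   Context: Convention: $\mathbf k$ is an algebraically closed field of prime characteristic $p$; everything is over $\mathbf k$. Rota-Baxter operator of weight $\lambda$ on a Lie algebra: a linear map $R$ such that $[R(x),R(y)]=R([R(x),y])+R([x,R(y)])+\lambda R([x,y])$ for all $x,y$. Rota-Baxter operator on a cocommutative Hopf algebra $H$ (with antipode $S$): a coalgebra endomorphism $R$ of $H$ such that $R(x)R(y)=R(x_1R(x_2)\,y\,S(R(x_3)))$ for all $x,y\in H$ (Sweedler notation). Extension to $\mathrm U(\mathfrak g)$ (Goncharov): a Rota-Baxter operator $R$ of weight $1$ on $\mathfrak g$ extends to a well-defined Rota-Baxter operator on the Hopf algebra $\mathrm U(\mathfrak g)$ (elements of $\mathfrak g$ primitive), determined by $R(1)=1$ and $R(xy)=R(x)R(y)-R([R(x),y])$ for $x\in\mathfrak g$, $y\in\mathrm U(\mathfrak g)$ (commutator in $\mathrm U(\mathfrak g)$). Restricted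 Lie algebra: a Lie algebra $(\mathfrak g,[-,-])$ with a $p$-map $(-)^{[p]}:\mathfrak g\to\mathfrak g$ satisfying $(ax)^{[p]}=a^px^{[p]}$ for $a\in\mathbf k$, $[x^{[p]},y]=(\mathrm{ad}_x)^p(y)$, and $(x+y)^{[p]}=x^{[p]}+y^{[p]}+\sum_{i=1}^{p-1}s_i(x,y)$, where $i\,s_i(x,y)$ is the coefficient of $t^{i-1}$ in $(\mathrm{ad}_{tx+y})^{p-1}(x)\in\mathbf k[t]\otimes\mathfrak g$. For a composition $\alpha=(\alpha_1,\dots,\alpha_r)\vDash n$ (a tuple of positive integers with sum $n$, of length $\ell(\alpha)=r$), $C_\alpha=\prod_{k=1}^r\binom{\alpha_1+\cdots+\alpha_k-1}{\alpha_k-1}$. A restricted Rota-Baxter Lie algebra $(\mathfrak g,[-,-],(-)^{[p]},R)$ of weight $\lambda$ is a restricted Lie algebra with a Rota-Baxter operator $R$ of weight $\lambda$ such that $R(x^{[p]_R})=R(x)^{[p]}$ for all $x\in\mathfrak g$, where, with $x\rhd_Ry:=[R(x),y]$ and $x^{\rhd_Rk}:=x\rhd_R(x\rhd_R\cdots(x\rhd_Rx)\cdots)$ ($k$ copies of $x$, $x^{\rhd_R1}=x$), $$x^{[p]_R}:=\lambda^{p-1}x^{[p]}+\sum_{r=1}^{p-1}\frac1r\lambda^{r-1}\sum_{\alpha\vDash p,\ \ell(\alpha)=r}C_\alpha\,[x^{\rhd_R\alpha_1},[x^{\rhd_R\alpha_2},[\cdots[x^{\rhd_R\alpha_{r-1}},x^{\rhd_R\alpha_r}]\cdots]]]$$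 ($\frac1r$ is the inverse of $r$ modulo $p$). *)

(* Defs.v *)
From HB Require Import structures.
From mathcomp Require Import all_boot all_order all_algebra.
From mathcomp Require Import generic_quotient ring_quotient.
From mathcomp Require Import boolp.
From mathcomp Require Import finmap.
From mathcomp Require Import monalg.

Set Implicit Arguments.
Unset Strict Implicit.
Unset Printing Implicit Defensive.

Import GRing.Theory.
Local Open Scope ring_scope.

Record subsp (k : fieldType) (V : lmodType k) := Subsp {
  subsp_pred :> V -> Prop;
  subsp0 : subsp_pred 0;
  subspP : forall (a : k) (u v : V),
    subsp_pred u -> subsp_pred v -> subsp_pred (a *: u + v)
}.

Section Subspace.
Variables (k : fieldType) (V : lmodType k) (S : subsp V).

Lemma subspZ a u : S u -> S (a *: u).
Proof. by move=> Su; rewrite -[_ *: _]addr0; apply: subspP => //; apply: subsp0. Qed.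

Lemma subspD u v : S u -> S v -> S (u + v).
Proof. by move=> Su Sv; rewrite -[u]scale1r; apply: subspP. Qed.

Lemma subspN u : S u -> S (- u).
Proof. by rewrite -scaleN1r; apply: subspZ. Qed.

Definition subsp_mem : V -> bool := fun v => `[< S v >].

Fact subsp_mem_zmod_closed : zmod_closed subsp_mem.
Proof.
split=> [|u v]; first exact/asboolP/subsp0.
move=> /asboolP Su /asboolP Sv; apply/asboolP.
by apply: subspD => //; apply: subspN.
Qed.
HB.instance Definition _ :=
  GRing.isZmodClosed.Build V subsp_mem subsp_mem_zmod_closed.

End Subspace.

Definition vquot (k : fieldType) (V : lmodType k) (S : subsp V) : Type :=
  Quotient.quot (GRing.ZmodClosed.clone V (subsp_mem S) _).
HB.instance Definition _ (k : fieldType) (V : lmodType k) (S : subsp V) :=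
  Choice.on (vquot S).

(* The quotient map and an arbitrary section of it. *)
HB.lock
Definition vpi (k : fieldType) (V : lmodType k) (S : subsp V) (v : V) :
    vquot S :=
  (\pi_(Quotient.quot (GRing.ZmodClosed.clone V (subsp_mem S) _)) v)%qT.
HB.lock
Definition vrepr (k : fieldType) (V : lmodType k) (S : subsp V) (q : vquot S) :
    V := repr q.
Arguments vpi {k V}.
Arguments vrepr {k V S}.

Section VectorQuotient.
Variables (k : fieldType) (V : lmodType k) (S : subsp V).
Local Notation Q := (vquot S).
Local Notation vpi := (vpi S).

Lemma vreprK (q : Q) : vpi (vrepr q) = q.
Proof. by rewrite vpi.unlock vrepr.unlock; apply: reprK. Qed.

Lemma vpi_eq u v : vpi u = vpi v <-> S (u - v).
Proof.
rewrite vpi.unlock; split=> [/eqP|H].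
  by rewrite -Quotient.idealrBE => /asboolP.
by apply/eqP; rewrite -Quotient.idealrBE; apply/asboolP.
Qed.

Lemma vrepr_pi v : S (vrepr (vpi v) - v).
Proof. by apply/vpi_eq; rewrite vreprK. Qed.

Definition vadd (q r : Q) : Q := vpi (vrepr q + vrepr r).
Definition vopp (q : Q) : Q := vpi (- vrepr q).

Lemma vaddE u v : vadd (vpi u) (vpi v) = vpi (u + v).
Proof. by apply/vpi_eq; rewrite opprD addrACA; apply/subspD; apply/vrepr_pi. Qed.
Lemma voppE u : vopp (vpi u) = vpi (- u).
Proof. by apply/vpi_eq; rewrite -opprD; apply/subspN/vrepr_pi. Qed.

Fact vaddA : associative vadd.
Proof.
by move=> p q r; rewrite -[p]vreprK -[q]vreprK -[r]vreprK !vaddE addrA.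
Qed.
Fact vaddC : commutative vadd.
Proof. by move=> p q; rewrite -[p]vreprK -[q]vreprK !vaddE addrC. Qed.
Fact vadd0 : left_id (vpi 0) vadd.
Proof. by move=> p; rewrite -[p]vreprK vaddE add0r. Qed.
Fact vaddN : left_inverse (vpi 0) vopp vadd.
Proof. by move=> p; rewrite -[p]vreprK voppE vaddE addNr. Qed.
HB.instance Definition _ := GRing.isZmodule.Build (vquot S)
  vaddA vaddC vadd0 vaddN.

Lemma vpiB : {morph vpi : u v / u - v}.
Proof. by move=> u v; rewrite -[RHS]/(vadd _ (vopp _)) voppE vaddE. Qed.
HB.instance Definition _ := GRing.isZmodMorphism.Build V (vquot S) vpi vpiB.

Definition vscale (a : k) (q : Q) : Q := vpi (a *: vrepr q).

Lemma vscaleE a v : vscale a (vpi v) = vpi (a *: v).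
Proof. by apply/vpi_eq; rewrite -scalerBr; apply/subspZ/vrepr_pi. Qed.

Fact vscaleA a b q : vscale a (vscale b q) = vscale (a * b) q.
Proof. by rewrite -[q]vreprK !vscaleE scalerA. Qed.
Fact vscale1 : left_id 1 vscale.
Proof. by move=> q; rewrite -[q]vreprK !vscaleE scale1r. Qed.
Fact vscaleDr : right_distributive vscale +%R.
Proof.
by move=> a q r; rewrite -[q]vreprK -[r]vreprK -raddfD !vscaleE -raddfD scalerDr.
Qed.
Fact vscaleDl q : {morph vscale^~ q : a b / a + b}.
Proof.
by move=> a b; rewrite -[q]vreprK !vscaleE scalerDl raddfD.
Qed.
HB.instance Definition _ := GRing.Zmodule_isLmodule.Build k (vquot S)
  vscaleA vscale1 vscaleDr vscaleDl.

Fact vpiZ : scalable vpi.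
Proof. by move=> a v; rewrite [RHS](vscaleE a v). Qed.
HB.instance Definition _ := GRing.isScalable.Build k V (vquot S) *:%R vpi vpiZ.

Lemma vpi_eq0 v : vpi v = 0 <-> S v.
Proof. by rewrite -[0](raddf0 vpi) vpi_eq subr0. Qed.

End VectorQuotient.

Section VectorQuotientLift.
Variables (k : fieldType) (V W : lmodType k) (S : subsp V) (f : {linear V -> W}).
Hypothesis f_kills : forall v, S v -> f v = 0.

Lemma vliftE v : f (vrepr (vpi S v)) = f v.
Proof.
have := f_kills (vrepr_pi S v); rewrite linearB => /eqP.
by rewrite subr_eq0 => /eqP.
Qed.

Lemma vlift_linear : linear (fun q : vquot S => f (vrepr q)).
Proof.
move=> a q r; rewrite -[q in LHS]vreprK -[r in LHS]vreprK -linearP vliftE.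
exact: linearP.
Qed.
End VectorQuotientLift.

Definition span (k : fieldType) (V : lmodType k) (N : V -> Prop) : subsp V.
Proof.
exists (fun v => forall S : subsp V, (forall x, N x -> S x) -> S v).
- by move=> S _; apply: subsp0.
- by move=> a u v Hu Hv S NS; apply: subspP; [apply: Hu|apply: Hv].
Defined.

Lemma span_gen (k : fieldType) (V : lmodType k) (N : V -> Prop) v :
  N v -> span N v.
Proof. by move=> Nv S; apply. Qed.

Lemma span_kernel (k : fieldType) (V W : lmodType k) (N : V -> Prop)
    (f : V -> W) :
  linear f -> (forall x, N x -> f x = 0) -> forall v, span N v -> f v = 0.
Proof.
move=> fL Nf v; have f0 : f 0 = 0.
  by have /= := fL (-1) 0 0; rewrite scaler0 addr0 scaleN1r addNr.
have fS a u w : f u = 0 -> f w = 0 -> f (a *: u + w) = 0.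
  by move=> fu fw; rewrite fL fu fw scaler0 addr0.
exact: (fun H => H (Subsp f0 fS) Nf).
Qed.

Section FreeModule.
Variables (k : fieldType) (K : choiceType).
Local Open Scope fset_scope.

Lemma malg_ind (P : {malg k[K]} -> Prop) :
  P 0%R -> (forall a u v, P u -> P v -> P (a *: u + v)%R) ->
  (forall x, P << x >>) -> forall g, P g.
Proof.
move=> P0 PD PU g; rewrite [g]monalgE; elim: (enum_fset _) => [|x s IH].
  by rewrite big_nil.
rewrite big_cons; suff -> : << g@_x *g x >> = g@_x *: << x >> by apply: PD.
by apply/malgP => y; rewrite mcoeffZ !mcoeffU mulr_natr.
Qed.

Variables (W : lmodType k) (f : K -> W).

Definition mlift (g : {malg k[K]}) : W := (\sum_(x <- msupp g) g@_x *: f x)%R.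

Lemma mliftEw (d : {fset K}) g :
  msupp g `<=` d -> mlift g = (\sum_(x <- d) g@_x *: f x)%R.
Proof.
move=> le; rewrite [LHS](big_fset_incl _ le) => //= x xd /mcoeff_outdom ->.
by rewrite scale0r.
Qed.

Lemma mlift_linear : linear mlift.
Proof.
move=> a g h; pose d := msupp (a *: g + h)%R `|` (msupp g `|` msupp h).
have dl : msupp (a *: g + h)%R `<=` d by rewrite fsubsetUl.
have dg : msupp g `<=` d by rewrite /d fsetUCA fsubsetUl.
have dh : msupp h `<=` d by rewrite /d fsetUA fsubsetUr.
rewrite (mliftEw dl) (mliftEw dg) (mliftEw dh) scaler_sumr -big_split /=.
by apply: eq_bigr => x _; rewrite mcoeffD mcoeffZ scalerDl scalerA.
Qed.
HB.instance Definition _ :=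
  GRing.isLinear.Build k {malg k[K]} W *:%R mlift mlift_linear.

Lemma mliftU x : mlift << x >> = f x.
Proof. by rewrite (mliftEw msuppU_le) big_seq_fset1 mcoeffUU scale1r. Qed.

End FreeModule.

Inductive tensor_rel (k : fieldType) (A B : lmodType k) :
    {malg k[(A * B)%type]} -> Prop :=
| tensor_rell (c : k) (a a' : A) (b : B) :
    tensor_rel (<< (c *: a + a', b) >> - (c *: << (a, b) >> + << (a', b) >>))
| tensor_relr (c : k) (a : A) (b b' : B) :
    tensor_rel (<< (a, c *: b + b') >> - (c *: << (a, b) >> + << (a, b') >>)).

Definition tensor (k : fieldType) (A B : lmodType k) : Type :=
  vquot (span (@tensor_rel k A B)).
HB.instance Definition _ (k : fieldType) (A B : lmodType k) :=
  GRing.Lmodule.on (tensor A B).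

HB.lock
Definition tens (k : fieldType) (A B : lmodType k) (a : A) (b : B) :
    tensor A B :=
  vpi (span (@tensor_rel k A B)) << (a, b) >>.

(* Meaningful only for a bilinear f, see tliftE. *)
HB.lock
Definition tlift (k : fieldType) (A B C : lmodType k) (f : A -> B -> C)
    (t : tensor A B) : C :=
  mlift (fun ab => f ab.1 ab.2) (vrepr t).

Arguments tens {k A B}.
Arguments tlift {k A B C}.

Section Tensor.
Variables (k : fieldType) (A B : lmodType k).
Local Notation tensor := (tensor A B).
Local Notation tensor_rel := (@tensor_rel k A B).

Definition bilin (C : lmodType k) (f : A -> B -> C) :=
  (forall b, linear (f^~ b)) /\ (forall a, linear (f a)).

Lemma tens_bilin : bilin tens.
Proof.
split=> [b c a a'|a c b b']; rewrite tens.unlock -linearP; apply/vpi_eq/span_gen.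
- exact: tensor_rell.
- exact: tensor_relr.
Qed.

Lemma tensor_ind (P : tensor -> Prop) :
  (forall c t u, P t -> P u -> P (c *: t + u)) ->
  (forall a b, P (tens a b)) ->
  forall t : tensor, P t.
Proof.
move=> PD PU t; rewrite -[t]vreprK; elim/malg_ind: (vrepr t) => [|c u v Pu Pv|[a b]].
- have : P (-1 *: tens 0 0 + tens 0 0) by apply: PD.
  by rewrite scaleN1r addNr raddf0.
- by rewrite linearP; apply: PD.
- by have := PU a b; rewrite tens.unlock.
Qed.

Section Lift.
Variables (C : lmodType k) (f : A -> B -> C) (fB : bilin f).

Let f_kills v : span tensor_rel v -> mlift (fun ab => f ab.1 ab.2) v = 0.
Proof.
apply: span_kernel; first exact: mlift_linear.
move=> _ [c a a' b|c a b b']; rewrite linearB linearP /= !mliftU /=.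
- by rewrite fB.1 subrr.
- by rewrite fB.2 subrr.
Qed.

Lemma tliftE a b : tlift f (tens a b) = f a b.
Proof.
rewrite tlift.unlock tens.unlock.
exact: etrans (vliftE f_kills _) (mliftU _ _).
Qed.

Lemma tlift_linear : linear (tlift f).
Proof. by rewrite tlift.unlock; apply: (vlift_linear f_kills). Qed.
End Lift.

Lemma tensor_eq (C : lmodType k) (f g : tensor -> C) :
  linear f -> linear g -> (forall a b, f (tens a b) = g (tens a b)) -> f =1 g.
Proof.
by move=> fL gL fg; elim/tensor_ind => [c t u IHt IHu|]; rewrite // fL gL IHt IHu.
Qed.

End Tensor.

Notation "a *t b" := (tens a b) (at level 40).

Lemma tens_linl (k : fieldType) (A B : lmodType k) (b : B) :
  linear (fun a : A => a *t b).
Proof. exact: (tens_bilin _ _).1. Qed.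

Lemma tens_linr (k : fieldType) (A B : lmodType k) (a : A) :
  linear (fun b : B => a *t b).
Proof. exact: (tens_bilin _ _).2. Qed.

Lemma linearid (k : fieldType) (A : lmodType k) : linear (fun x : A => x).
Proof. by []. Qed.

Lemma linearcomp (k : fieldType) (A B C : lmodType k) (f : A -> B) (g : B -> C) :
  linear f -> linear g -> linear (fun x => g (f x)).
Proof. by move=> fL gL c x y; rewrite fL gL. Qed.

Lemma linswap (k : fieldType) (A : lmodType k) (c d : k) (x x' y y' : A) :
  c *: (d *: x + x') + (d *: y + y') = d *: (c *: x + y) + (c *: x' + y').
Proof. by rewrite !scalerDr !scalerA mulrC !addrA (addrAC (_ *: x)). Qed.

Definition tmap (k : fieldType) (A B A' B' : lmodType k) (f : A -> A')
    (g : B -> B') : tensor A B -> tensor A' B' :=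
  tlift (fun a b => f a *t g b).

Definition tassoc (k : fieldType) (A B C : lmodType k) :
    tensor (tensor A B) C -> tensor A (tensor B C) :=
  tlift (fun t c => tlift (fun a b => a *t (b *t c)) t).

Definition tswap (k : fieldType) (A B : lmodType k) :
    tensor A B -> tensor B A :=
  tlift (fun a b => b *t a).

Section TensorMaps.
Variables (k : fieldType).

Section Map.
Variables (A B A' B' : lmodType k) (f : A -> A') (g : B -> B').
Hypotheses (fL : linear f) (gL : linear g).

Lemma tmap_bilin : bilin (fun a b => f a *t g b).
Proof.
by split=> [b|a] c x y /=; [rewrite fL tens_linl|rewrite gL tens_linr].
Qed.
Lemma tmapE a b : tmap f g (a *t b) = f a *t g b.
Proof. exact/tliftE/tmap_bilin. Qed.
Lemma tmap_linear : linear (tmap f g).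
Proof. exact/tlift_linear/tmap_bilin. Qed.
End Map.

Variables (A B C : lmodType k).

Lemma tassoc_bilin1 (c : C) : bilin (fun (a : A) (b : B) => a *t (b *t c)).
Proof.
by split=> [b|a] d x y /=; [rewrite tens_linl|rewrite tens_linl tens_linr].
Qed.
Lemma tassoc_bilin :
  bilin (fun (t : tensor A B) (c : C) => tlift (fun a b => a *t (b *t c)) t).
Proof.
split=> [c|t] d x y /=; first by rewrite (tlift_linear (tassoc_bilin1 c)).
elim/tensor_ind: t => [e t u IHt IHu|a b].
  rewrite (tlift_linear (tassoc_bilin1 (d *: x + y)) e) IHt IHu.
  rewrite (tlift_linear (tassoc_bilin1 x) e) (tlift_linear (tassoc_bilin1 y) e).
  exact: linswap.
by rewrite 3!(tliftE (tassoc_bilin1 _)) 2!tens_linr.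
Qed.
Lemma tassocE (a : A) (b : B) (c : C) : tassoc (a *t b *t c) = a *t (b *t c).
Proof. by rewrite /tassoc (tliftE tassoc_bilin) (tliftE (tassoc_bilin1 c)). Qed.
Lemma tassoc_linear : linear (@tassoc k A B C).
Proof. exact/tlift_linear/tassoc_bilin. Qed.

Lemma tswap_bilin : bilin (fun (a : A) (b : B) => b *t a).
Proof. by split=> [b|a] d x y /=; rewrite ?tens_linl ?tens_linr. Qed.
Lemma tswapE (a : A) (b : B) : tswap (a *t b) = b *t a.
Proof. exact/tliftE/tswap_bilin. Qed.
Lemma tswap_linear : linear (@tswap k A B).
Proof. exact/tlift_linear/tswap_bilin. Qed.
End TensorMaps.

(* The counit is separated from the rest of the Hopf structure because the
   algebra structure on tensor A B requires 1 != 0, which the two counits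
   provide. *)
HB.mixin Record isAugmented (k : fieldType) A of GRing.Algebra k A := {
  counit : A -> k;
  counit_linear : linear_for *%R counit;
  counit1 : counit 1 = 1;
  counitM : forall x y, counit (x * y) = counit x * counit y
}.
#[short(type="augAlgType")]
HB.structure Definition AugAlgebra (k : fieldType) :=
  {A of GRing.Algebra k A & isAugmented k A}.

HB.lock
Definition tmul (k : fieldType) (A B : augAlgType k) (t u : tensor A B) :
    tensor A B :=
  tlift (fun a b => tlift (fun a' b' => (a * a') *t (b * b')) u) t.
Arguments tmul {k A B}.

Section TensorAlgebra.
Variables (k : fieldType) (A B : augAlgType k).
Local Notation T := (tensor A B).

Lemma tmul_bilin1 a b : bilin (fun (a' : A) (b' : B) => (a * a') *t (b * b')).
Proof.
by split=> [b'|a'] c x y /=;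
  rewrite mulrDr -scalerAr ?tens_linl ?tens_linr.
Qed.

Lemma tmul_bilin2 u :
  bilin (fun (a : A) (b : B) => tlift (fun a' b' => (a * a') *t (b * b')) u).
Proof.
split=> [b|a] c x y /=; elim/tensor_ind: u => [d t u IHt IHu|a' b'].
- rewrite (tlift_linear (tmul_bilin1 _ _) d) IHt IHu.
  rewrite (tlift_linear (tmul_bilin1 x b) d) (tlift_linear (tmul_bilin1 y b) d).
  exact: linswap.
- by rewrite 3!(tliftE (tmul_bilin1 _ _)) mulrDl -scalerAl tens_linl.
- rewrite (tlift_linear (tmul_bilin1 _ _) d) IHt IHu.
  rewrite (tlift_linear (tmul_bilin1 a x) d) (tlift_linear (tmul_bilin1 a y) d).
  exact: linswap.
- by rewrite 3!(tliftE (tmul_bilin1 _ _)) mulrDl -scalerAl tens_linr.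
Qed.

Lemma tmulE (a : A) (b : B) a' b' : tmul (a *t b) (a' *t b') = (a * a') *t (b * b').
Proof. by rewrite tmul.unlock (tliftE (tmul_bilin2 _)) (tliftE (tmul_bilin1 _ _)). Qed.

Lemma tmul_linl (u : T) : linear (tmul^~ u).
Proof. by rewrite tmul.unlock; apply/tlift_linear/tmul_bilin2. Qed.

Lemma tmul_linr (t : T) : linear (tmul t).
Proof.
move=> c x y; elim/tensor_ind: t => [d t u IHt IHu|a b].
  rewrite (tmul_linl (c *: x + y)) IHt IHu (tmul_linl x) (tmul_linl y).
  exact: linswap.
by rewrite tmul.unlock 3!(tliftE (tmul_bilin2 _)) (tlift_linear (tmul_bilin1 _ _)).
Qed.

Fact tmulA : associative (@tmul k A B).
Proof.
move=> t u v.
elim/tensor_ind: t => [c x y Hx Hy|a b].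
  by rewrite tmul_linl Hx Hy (tmul_linl u) tmul_linl.
elim/tensor_ind: u => [c x y Hx Hy|a' b'].
  by rewrite (tmul_linl v c x y) !(tmul_linr (a *t b)) Hx Hy tmul_linl.
elim/tensor_ind: v => [c x y Hx Hy|a'' b''].
  by rewrite !tmul_linr Hx Hy.
by rewrite 4!tmulE 2!mulrA.
Qed.
Fact tmul1l : left_id (1 *t 1) (@tmul k A B).
Proof.
elim/tensor_ind => [c x y Hx Hy|a b]; first by rewrite tmul_linr Hx Hy.
by rewrite tmulE !mul1r.
Qed.
Fact tmul1r : right_id (1 *t 1) (@tmul k A B).
Proof.
elim/tensor_ind => [c x y Hx Hy|a b]; first by rewrite tmul_linl Hx Hy.
by rewrite tmulE !mulr1.
Qed.
Fact tmulDl : left_distributive (@tmul k A B) +%R.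
Proof. by move=> t u v; have := tmul_linl v 1 t u; rewrite !scale1r. Qed.
Fact tmulDr : right_distributive (@tmul k A B) +%R.
Proof. by move=> t u v; have := tmul_linr t 1 u v; rewrite !scale1r. Qed.

Definition tcounit : T -> k := 
  @tlift k A B k^o (fun a b => counit a * counit b).
Fact tcounit_bilin :
  @bilin k A B k^o (fun (a : A) (b : B) => counit a * counit b).
Proof.
split=> [b|a] c x y /=; rewrite counit_linear ?mulrDl ?mulrDr //.
  by rewrite -mulrA.
by rewrite mulrCA.
Qed.
Lemma tcounitE a b : tcounit (a *t b) = counit a * counit b.
Proof. exact: (tliftE tcounit_bilin). Qed.
Fact tcounit_linear : linear_for *%R tcounit.
Proof. exact: (tlift_linear tcounit_bilin). Qed.

Fact tone_neq0 : (1 *t 1 : T) != 0.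
Proof.
apply/eqP => /(congr1 tcounit); rewrite tcounitE !counit1 mulr1.
have -> : tcounit 0 = 0.
  by have := tcounit_linear (-1) 0 0; rewrite scaler0 addr0 mulN1r addNr.
exact/eqP/oner_neq0.
Qed.

HB.instance Definition _ := GRing.Zmodule_isNzRing.Build T
  tmulA tmul1l tmul1r tmulDl tmulDr tone_neq0.

Fact tscaleAl (c : k) (t u : T) : c *: (t * u) = (c *: t) * u.
Proof.
have u0 : tmul 0 u = 0 := mul0r u.
have H : tmul (c *: t + 0) u = c *: tmul t u + tmul 0 u := tmul_linl u c t 0.
by rewrite u0 !addr0 in H; apply: esym.
Qed.
HB.instance Definition _ := GRing.Lmodule_isLalgebra.Build k T tscaleAl.
Fact tscaleAr (c : k) (t u : T) : c *: (t * u) = t * (c *: u).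
Proof.
have t0 : tmul t 0 = 0 := mulr0 t.
have H : tmul t (c *: u + 0) = c *: tmul t u + tmul t 0 := tmul_linr t c u 0.
by rewrite t0 !addr0 in H; apply: esym.
Qed.
HB.instance Definition _ := GRing.Lalgebra_isAlgebra.Build k T tscaleAr.

Lemma tensM (a a' : A) (b b' : B) :
  (a *t b : T) * (a' *t b') = (a * a') *t (b * b').
Proof. exact: tmulE. Qed.

Lemma tens1 : (1 *t 1 : T) = 1.
Proof. by []. Qed.

Fact tcounit1 : tcounit 1 = 1.
Proof. by rewrite -tens1 tcounitE !counit1 mulr1. Qed.
Fact tcounitM t u : tcounit (t * u) = tcounit t * tcounit u.
Proof.
elim/tensor_ind: t => [c x y Hx Hy|a b].
  by rewrite mulrDl -scalerAl !tcounit_linear Hx Hy mulrDl mulrA.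
elim/tensor_ind: u => [c x y Hx Hy|a' b'].
  by rewrite mulrDr -scalerAr !tcounit_linear Hx Hy mulrDr mulrCA.
by rewrite tensM !tcounitE !counitM mulrACA.
Qed.
HB.instance Definition _ := isAugmented.Build k T
  tcounit_linear tcounit1 tcounitM.

End TensorAlgebra.

Lemma lin0 (k : fieldType) (V W : lmodType k) (f : V -> W) :
  linear f -> f 0 = 0.
Proof.
by move=> fL; have := fL (-1) 0 0; rewrite scaler0 addr0 scaleN1r addNr.
Qed.

Lemma linear_add (k : fieldType) (A B : lmodType k) (f g : A -> B) :
  linear f -> linear g -> linear (fun x => f x + g x).
Proof.
by move=> fL gL c x y; rewrite fL gL scalerDr addrACA.
Qed.

Lemma tmap_comp (k : fieldType) (A B A' B' A'' B'' : lmodType k)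
    (f : A -> A') (g : B -> B') (f' : A' -> A'') (g' : B' -> B'')
    (f'' : A -> A'') (g'' : B -> B'') :
  linear f -> linear g -> linear f' -> linear g' ->
  (forall a, f' (f a) = f'' a) -> (forall b, g' (g b) = g'' b) ->
  forall t, tmap f' g' (tmap f g t) = tmap f'' g'' t.
Proof.
move=> fL gL f'L g'L fE gE.
have f''L : linear f'' by move=> c x y; rewrite -!fE fL f'L.
have g''L : linear g'' by move=> c x y; rewrite -!gE gL g'L.
apply: (tensor_eq (f := fun t => tmap f' g' (tmap f g t))).
- by apply: (linearcomp (f := tmap f g)); apply: tmap_linear.
- exact: tmap_linear.
- by move=> a b; rewrite !tmapE // fE gE.
Qed.

Lemma tassoc_tmap (k : fieldType) (A B C A' B' C' : lmodType k)
    (f : A -> A') (g : B -> B') (h : C -> C') :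
  linear f -> linear g -> linear h -> forall t,
  tassoc (tmap (tmap f g) h t) = tmap f (tmap g h) (tassoc t).
Proof.
move=> fL gL hL; have fgL := tmap_linear fL gL; have ghL := tmap_linear gL hL.
have FL := tmap_linear fgL hL; have GL := tmap_linear fL ghL.
apply: (tensor_eq (f := fun t => tassoc (tmap (tmap f g) h t))
                  (g := fun t => tmap f (tmap g h) (tassoc t))).
- exact: (linearcomp FL (@tassoc_linear _ _ _ _)).
- exact: (linearcomp (@tassoc_linear _ _ _ _) GL).
move=> t c; have XL := @tens_linl k (tensor A B) C c.
move: t; apply: (tensor_eq
    (f := fun t => tassoc (tmap (tmap f g) h (t *t c)))
    (g := fun t => tmap f (tmap g h) (tassoc (t *t c)))).
- exact: (linearcomp (linearcomp XL FL) (@tassoc_linear _ _ _ _)).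
- exact: (linearcomp (linearcomp XL (@tassoc_linear _ _ _ _)) GL).
by move=> a b; rewrite tassocE !tmapE // tassocE.
Qed.

Section TensorRing.
Variables (k : fieldType).

Lemma tensor_eq2 (A B A' B' W : lmodType k)
    (f g : tensor A B -> tensor A' B' -> W) :
  bilin f -> bilin g ->
  (forall a b a' b', f (a *t b) (a' *t b') = g (a *t b) (a' *t b')) ->
  forall t u, f t u = g t u.
Proof.
move=> [fl fr] [gl gr] fg t u; elim/tensor_ind: t => [c x y Hx Hy|a b].
  by rewrite fl gl Hx Hy.
elim/tensor_ind: u => [c x y Hx Hy|a' b'] //.
by rewrite fr gr Hx Hy.
Qed.

Lemma morphM_bilin (A B : algType k) (f : A -> B) :
  linear f ->
  bilin (fun x y => f (x * y)) /\ bilin (fun x y => f x * f y).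
Proof.
move=> fL; split; split=> [x|x] c y z.
- by rewrite mulrDl -scalerAl fL.
- by rewrite mulrDr -scalerAr fL.
- by rewrite fL mulrDl -scalerAl.
- by rewrite fL mulrDr -scalerAr.
Qed.

Lemma tensor_morphM (A B : augAlgType k) (C : algType k) (f : tensor A B -> C) :
  linear f ->
  (forall a b a' b', f ((a * a') *t (b * b')) = f (a *t b) * f (a' *t b')) ->
  {morph f : t u / t * u}.
Proof.
move=> fL fM; have [B1 B2] := morphM_bilin fL.
by apply: (tensor_eq2 B1 B2) => a b a' b'; rewrite tensM.
Qed.

Lemma tmapM (A B C D : augAlgType k) (f : A -> C) (g : B -> D) :
  linear f -> linear g ->
  {morph f : x y / x * y} -> {morph g : x y / x * y} ->
  {morph tmap f g : t u / t * u}.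
Proof.
move=> fL gL fM gM; apply: tensor_morphM; first exact: tmap_linear.
by move=> a b a' b'; rewrite !tmapE // tensM fM gM.
Qed.

Lemma tswapM (A B : augAlgType k) : {morph @tswap k A B : t u / t * u}.
Proof.
apply: tensor_morphM; first exact: tswap_linear.
by move=> a b a' b'; rewrite !tswapE tensM.
Qed.

End TensorRing.

HB.mixin Record isHopf (k : fieldType) H of AugAlgebra k H := {
  comul : H -> tensor H H;
  antipode : H -> H;
  comul_linear : linear comul;
  comul1 : comul 1 = 1;
  comulM : forall x y, comul (x * y) = comul x * comul y;
  comulA : forall x,
    tassoc (tmap comul idfun (comul x)) = tmap idfun comul (comul x);
  comul_counitl : forall x, tlift (fun a b => counit a *: b) (comul x) = x;
  comul_counitr : forall x, tlift (fun a b => counit b *: a) (comul x) = x;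
  antipode_linear : linear antipode;
  antipodel : forall x,
    tlift (fun a b => antipode a * b) (comul x) = counit x *: 1;
  antipoder : forall x,
    tlift (fun a b => a * antipode b) (comul x) = counit x *: 1
}.
#[short(type="hopfAlgType")]
HB.structure Definition HopfAlgebra (k : fieldType) :=
  {H of AugAlgebra k H & isHopf k H}.

HB.mixin Record isCocommutative (k : fieldType) H of HopfAlgebra k H := {
  comulC : forall x : H, tswap (comul x) = comul x
}.
#[short(type="cocommHopfAlgType")]
HB.structure Definition CocommHopfAlgebra (k : fieldType) :=
  {H of HopfAlgebra k H & isCocommutative k H}.

Definition primitive (k : fieldType) (H : hopfAlgType k) (z : H) :=
  comul z = z *t 1 + 1 *t z.

Section HopfBilin.
Variables (k : fieldType) (H : hopfAlgType k).

Lemma counitl_bilin (A : augAlgType k) :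
  bilin (fun a b : A => counit a *: b).
Proof.
split=> [b|a] c x y /=; first by rewrite counit_linear scalerDl scalerA.
by rewrite scalerDr !scalerA mulrC.
Qed.
Lemma counitr_bilin (A : augAlgType k) :
  bilin (fun a b : A => counit b *: a).
Proof.
split=> [b|a] c x y /=; last by rewrite counit_linear scalerDl scalerA.
by rewrite scalerDr !scalerA mulrC.
Qed.
Lemma mull_bilin (A : algType k) (S : A -> A) :
  linear S -> bilin (fun a b : A => S a * b).
Proof.
move=> SL; split=> [b|a] c x y /=; first by rewrite SL mulrDl scalerAl.
by rewrite mulrDr scalerAr.
Qed.
Lemma mulr_bilin (A : algType k) (S : A -> A) :
  linear S -> bilin (fun a b : A => a * S b).
Proof.
move=> SL; split=> [b|a] c x y /=; last by rewrite SL mulrDr scalerAr.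
by rewrite mulrDl scalerAl.
Qed.

Lemma antipode1 : antipode 1 = 1 :> H.
Proof.
have := antipodel (1 : H); rewrite comul1 -tens1.
by rewrite (tliftE (mull_bilin (@antipode_linear k H))) mulr1 counit1 scale1r.
Qed.

Lemma prim_counit (z : H) : primitive z -> counit z = 0.
Proof.
move=> zP; have E := comul_counitl z; rewrite zP in E.
have L := tlift_linear (counitl_bilin H).
rewrite -[z *t 1]scale1r L !(tliftE (counitl_bilin H)) counit1 !scale1r in E.
move/eqP: E; rewrite -subr_eq0 addrK scaler_eq0 => /orP[/eqP //|].
by rewrite oner_eq0.
Qed.

Lemma prim_antipode (z : H) : primitive z -> antipode z = - z.
Proof.
move=> zP; have E := antipodel z; rewrite zP (prim_counit zP) in E.
have B := mull_bilin (@antipode_linear k H).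
rewrite -[z *t 1]scale1r (tlift_linear B) !(tliftE B) antipode1 in E.
rewrite scale1r mulr1 mul1r scale0r in E.
by apply/eqP; rewrite -addr_eq0 E.
Qed.
End HopfBilin.

Section Ideal.
Variables (k : fieldType) (A : algType k) (P : A -> Prop).

Definition is_ideal (I : A -> Prop) :=
  forall a x, I x -> I (a * x) /\ I (x * a).

Definition ideal : subsp A.
Proof.
exists (fun x => forall I : subsp A, is_ideal I -> (forall z, P z -> I z) -> I x).
- by move=> I _ _; apply: subsp0.
- by move=> c x y Hx Hy I II PI; apply: subspP; [apply: Hx|apply: Hy].
Defined.

Lemma ideal_gen z : P z -> ideal z.
Proof. by move=> Pz I _; apply. Qed.

Lemma ideal_ideal : is_ideal ideal.
Proof.
by move=> a x Ix; split=> I II PI; have [] := II a x (Ix I II PI).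
Qed.

Lemma ideal_kernel (W : lmodType k) (f : A -> W) :
  linear f -> (forall z, P z -> f z = 0) -> is_ideal (fun x => f x = 0) ->
  forall x, ideal x -> f x = 0.
Proof.
move=> fL Pf fI x.
have fS a u w : f u = 0 -> f w = 0 -> f (a *: u + w) = 0.
  by move=> fu fw; rewrite fL fu fw scaler0 addr0.
exact: (fun H => H (Subsp (lin0 fL) fS) fI Pf).
Qed.
End Ideal.

(* A set of primitive elements of H generates a Hopf ideal.  The second
   property holds in any Hopf algebra; it is recorded here rather than derived
   from the axioms. *)
Record primset (k : fieldType) (H : cocommHopfAlgType k) := PrimSet {
  primset_pred :> H -> Prop;
  primset_prim : forall z, primset_pred z -> primitive z;
  primset_anti : forall x y : H, antipode (x * y) = antipode y * antipode x
}.

Definition hquot (k : fieldType) (H : cocommHopfAlgType k) (P : primset H) :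
  Type := vquot (ideal P).
HB.instance Definition _ (k : fieldType) (H : cocommHopfAlgType k)
  (P : primset H) := GRing.Lmodule.on (hquot P).

Definition hpi (k : fieldType) (H : cocommHopfAlgType k) (P : primset H) (x : H) :
  hquot P := vpi (ideal P) x.

Section HopfQuotient.
Variables (k : fieldType) (H : cocommHopfAlgType k) (P : primset H).
Local Notation Q := (hquot P).
Local Notation hpi := (hpi P).
Implicit Types (q r s : Q) (x y : H).

Lemma hpi_linear : linear hpi.
Proof. exact: linearP. Qed.

Lemma hpi_eq x y : hpi x = hpi y <-> ideal P (x - y).
Proof. exact: vpi_eq. Qed.

Lemma hpi_eq0 x : hpi x = 0 <-> ideal P x.
Proof. exact: vpi_eq0. Qed.

Lemma hpi_surj q : exists x, q = hpi x.
Proof. by exists (vrepr q); rewrite /hpi vreprK. Qed.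

Definition hmul q r : Q := hpi (vrepr q * vrepr r).

Lemma hmulE x y : hmul (hpi x) (hpi y) = hpi (x * y).
Proof.
apply/hpi_eq; set x' := vrepr _; set y' := vrepr _.
have Ix : ideal P (x' - x) := vrepr_pi _ _.
have Iy : ideal P (y' - y) := vrepr_pi _ _.
have -> : x' * y' - x * y = (x' - x) * y' + x * (y' - y).
  by rewrite mulrBl mulrBr addrA subrK.
by apply: subspD; [apply: (ideal_ideal _ Ix).2|apply: (ideal_ideal _ Iy).1].
Qed.

Fact hmulA : associative hmul.
Proof.
move=> q r s; have [[x ->] [y ->] [z ->]] := And3 (hpi_surj q) (hpi_surj r) (hpi_surj s).
by rewrite !hmulE mulrA.
Qed.
Fact hmul1l : left_id (hpi 1) hmul.
Proof. by move=> q; have [x ->] := hpi_surj q; rewrite hmulE mul1r. Qed.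
Fact hmul1r : right_id (hpi 1) hmul.
Proof. by move=> q; have [x ->] := hpi_surj q; rewrite hmulE mulr1. Qed.

Lemma hpiD x y : hpi (x + y) = hpi x + hpi y.
Proof. exact: raddfD. Qed.
Lemma hpiB x y : hpi (x - y) = hpi x - hpi y.
Proof. exact: raddfB. Qed.
Lemma hpiZ c x : hpi (c *: x) = c *: hpi x.
Proof. exact: linearZ. Qed.

Fact hmulDl : left_distributive hmul +%R.
Proof.
move=> q r s; have [[x ->] [y ->] [z ->]] := And3 (hpi_surj q) (hpi_surj r) (hpi_surj s).
by rewrite -hpiD !hmulE mulrDl hpiD.
Qed.
Fact hmulDr : right_distributive hmul +%R.
Proof.
move=> q r s; have [[x ->] [y ->] [z ->]] := And3 (hpi_surj q) (hpi_surj r) (hpi_surj s).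
by rewrite -hpiD !hmulE mulrDr hpiD.
Qed.

Definition hcounit q : k := counit (vrepr q).

Lemma counit_kills x : ideal P x -> counit x = 0.
Proof.
apply: (@ideal_kernel _ _ _ k^o (@counit k H)).
- exact: counit_linear.
- by move=> z /primset_prim/prim_counit.
- by move=> a z z0; split; rewrite counitM z0 ?mul0r ?mulr0.
Qed.

Lemma hcounitE x : hcounit (hpi x) = counit x.
Proof.
apply/eqP; rewrite -subr_eq0; apply/eqP.
have := counit_kills (vrepr_pi (ideal P) x).
by rewrite -scaleN1r addrC counit_linear mulN1r addrC.
Qed.

Fact hone_neq0 : hpi 1 != 0.
Proof.
apply/eqP => /hpi_eq0/counit_kills/eqP.
by rewrite counit1 oner_eq0.
Qed.

HB.instance Definition _ := GRing.Zmodule_isNzRing.Build (hquot P)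
  hmulA hmul1l hmul1r hmulDl hmulDr hone_neq0.

Lemma hpiM x y : hpi (x * y) = hpi x * hpi y.
Proof. by rewrite -hmulE. Qed.
Lemma hpi1 : hpi 1 = 1.
Proof. by []. Qed.

Fact hscaleAl (c : k) q r : c *: (q * r) = (c *: q) * r.
Proof.
have [[x ->] [y ->]] := conj (hpi_surj q) (hpi_surj r).
by rewrite -hpiM -!hpiZ -hpiM scalerAl.
Qed.
HB.instance Definition _ := GRing.Lmodule_isLalgebra.Build k (hquot P) hscaleAl.
Fact hscaleAr (c : k) q r : c *: (q * r) = q * (c *: r).
Proof.
have [[x ->] [y ->]] := conj (hpi_surj q) (hpi_surj r).
by rewrite -hpiM -!hpiZ -hpiM scalerAr.
Qed.
HB.instance Definition _ := GRing.Lalgebra_isAlgebra.Build k (hquot P) hscaleAr.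

Fact hcounit_linear : linear_for *%R hcounit.
Proof.
move=> c q r; have [[x ->] [y ->]] := conj (hpi_surj q) (hpi_surj r).
by rewrite -hpi_linear !hcounitE counit_linear.
Qed.
Fact hcounit1 : hcounit 1 = 1.
Proof. by rewrite -hpi1 hcounitE counit1. Qed.
Fact hcounitM q r : hcounit (q * r) = hcounit q * hcounit r.
Proof.
have [[x ->] [y ->]] := conj (hpi_surj q) (hpi_surj r).
by rewrite -hpiM !hcounitE counitM.
Qed.
HB.instance Definition _ := isAugmented.Build k (hquot P)
  hcounit_linear hcounit1 hcounitM.

Definition hcomul q : tensor Q Q := tmap hpi hpi (comul (vrepr q)).

Let D x : tensor Q Q := tmap hpi hpi (comul x).
Let D_linear : linear D.
Proof. by move=> c x y; rewrite /D comul_linear (tmap_linear hpi_linear hpi_linear). Qed.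
Let DM x y : D (x * y) = D x * D y.
Proof.
by rewrite /D comulM (tmapM hpi_linear hpi_linear hpiM hpiM).
Qed.
Let D_kills x : ideal P x -> D x = 0.
Proof.
apply: ideal_kernel => // [z Pz|a z z0]; last by split; rewrite DM z0 ?mul0r ?mulr0.
rewrite /D (primset_prim Pz) -[z *t 1]scale1r.
rewrite (tmap_linear hpi_linear hpi_linear) !(tmapE hpi_linear hpi_linear).
have -> : hpi z = 0 by apply/hpi_eq0/ideal_gen.
rewrite (lin0 (tens_linl _)) (lin0 (tens_linr _)).
by rewrite scaler0 addr0.
Qed.

Lemma hcomulE x : hcomul (hpi x) = tmap hpi hpi (comul x).
Proof.
have := D_kills (vrepr_pi (ideal P) x); rewrite -scaleN1r addrC D_linear.
by rewrite scaleN1r addrC => /eqP; rewrite subr_eq0 => /eqP.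
Qed.

Definition hantipode q : Q := hpi (antipode (vrepr q)).

Lemma antipode_kills x : ideal P x -> hpi (antipode x) = 0.
Proof.
apply: (@ideal_kernel _ _ _ _ (fun x => hpi (antipode x))).
- by move=> c y z; rewrite antipode_linear hpi_linear.
- move=> z Pz; rewrite (prim_antipode (primset_prim Pz)).
  by apply/hpi_eq0/subspN/ideal_gen.
- by move=> a z z0; split; rewrite (primset_anti P) hpiM z0 ?mul0r ?mulr0.
Qed.

Lemma hantipodeE x : hantipode (hpi x) = hpi (antipode x).
Proof.
have := antipode_kills (vrepr_pi (ideal P) x); rewrite -scaleN1r addrC.
rewrite antipode_linear hpi_linear scaleN1r addrC => /eqP.
by rewrite subr_eq0 => /eqP.
Qed.

Fact hcomul_linear : linear hcomul.
Proof.
move=> c q r; have [[x ->] [y ->]] := conj (hpi_surj q) (hpi_surj r).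
by rewrite -hpi_linear !hcomulE; apply: D_linear.
Qed.
Fact hantipode_linear : linear hantipode.
Proof.
move=> c q r; have [[x ->] [y ->]] := conj (hpi_surj q) (hpi_surj r).
by rewrite -hpi_linear !hantipodeE antipode_linear hpi_linear.
Qed.
Fact hcomul1 : hcomul 1 = 1.
Proof. by rewrite -hpi1 hcomulE comul1 -tens1 (tmapE hpi_linear hpi_linear). Qed.
Fact hcomulM q r : hcomul (q * r) = hcomul q * hcomul r.
Proof.
have [[x ->] [y ->]] := conj (hpi_surj q) (hpi_surj r).
by rewrite -hpiM !hcomulE; apply: DM.
Qed.

Fact hcomulA q :
  tassoc (tmap hcomul idfun (hcomul q)) = tmap idfun hcomul (hcomul q).
Proof.
have [x ->] := hpi_surj q; rewrite hcomulE.
have HL := hpi_linear; have CL := hcomul_linear; have dL := @comul_linear k H.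
have iL (V : lmodType k) : linear (@idfun V) by [].
have TL := tmap_linear HL HL.
rewrite (tmap_comp HL HL CL (iL Q) (f'' := D) (g'' := hpi)) //; last first.
  by move=> a; rewrite hcomulE.
rewrite (tmap_comp HL HL (iL Q) CL (f'' := hpi) (g'' := D)) //; last first.
  by move=> a; rewrite hcomulE.
rewrite -(tmap_comp dL (iL H) TL HL (f'' := D) (g'' := hpi)) //.
rewrite -(tmap_comp (iL H) dL HL TL (f'' := hpi) (g'' := D)) //.
by rewrite (tassoc_tmap HL HL HL) comulA.
Qed.

Fact hcomul_counitl q : tlift (fun a b => counit a *: b) (hcomul q) = q.
Proof.
have [x ->] := hpi_surj q; rewrite hcomulE -[in RHS](comul_counitl x).
have B A := @counitl_bilin k A; have HL := hpi_linear.
move: (comul x); apply: tensor_eq => [||a b].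
- exact: (linearcomp (tmap_linear HL HL) (tlift_linear (B _))).
- exact: (linearcomp (tlift_linear (B _)) HL).
- by rewrite tmapE // !(tliftE (B _)) [counit _]hcounitE hpiZ.
Qed.
Fact hcomul_counitr q : tlift (fun a b => counit b *: a) (hcomul q) = q.
Proof.
have [x ->] := hpi_surj q; rewrite hcomulE -[in RHS](comul_counitr x).
have B A := @counitr_bilin k A; have HL := hpi_linear.
move: (comul x); apply: tensor_eq => [||a b].
- exact: (linearcomp (tmap_linear HL HL) (tlift_linear (B _))).
- exact: (linearcomp (tlift_linear (B _)) HL).
- by rewrite tmapE // !(tliftE (B _)) [counit _]hcounitE hpiZ.
Qed.
Fact hantipodel q :
  tlift (fun a b => hantipode a * b) (hcomul q) = counit q *: 1.
Proof.
have [x ->] := hpi_surj q; rewrite hcomulE [counit _]hcounitE -hpi1 -hpiZ -antipodel.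
have B := mull_bilin hantipode_linear; have HL := hpi_linear.
have B' := mull_bilin (@antipode_linear k H).
move: (comul x); apply: tensor_eq => [||a b].
- exact: (linearcomp (tmap_linear HL HL) (tlift_linear B)).
- exact: (linearcomp (tlift_linear B') HL).
- by rewrite tmapE // (tliftE B) (tliftE B') hpiM hantipodeE.
Qed.
Fact hantipoder q :
  tlift (fun a b => a * hantipode b) (hcomul q) = counit q *: 1.
Proof.
have [x ->] := hpi_surj q; rewrite hcomulE [counit _]hcounitE -hpi1 -hpiZ -antipoder.
have B := mulr_bilin hantipode_linear; have HL := hpi_linear.
have B' := mulr_bilin (@antipode_linear k H).
move: (comul x); apply: tensor_eq => [||a b].
- exact: (linearcomp (tmap_linear HL HL) (tlift_linear B)).
- exact: (linearcomp (tlift_linear B') HL).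
- by rewrite tmapE // (tliftE B) (tliftE B') hpiM hantipodeE.
Qed.

HB.instance Definition _ := isHopf.Build k (hquot P)
  hcomul_linear hcomul1 hcomulM hcomulA hcomul_counitl hcomul_counitr
  hantipode_linear hantipodel hantipoder.

Fact hcomulC q : tswap (hcomul q) = hcomul q.
Proof.
have [x ->] := hpi_surj q; rewrite hcomulE -[in RHS]comulC.
have HL := hpi_linear; have sL := @tswap_linear k.
move: (comul x); apply: tensor_eq => [||a b].
- exact: (linearcomp (tmap_linear HL HL) (sL _ _)).
- exact: (linearcomp (sL _ _) (tmap_linear HL HL)).
- by rewrite tmapE // !tswapE tmapE.
Qed.
HB.instance Definition _ := isCocommutative.Build k (hquot P) hcomulC.

Lemma hantiM q r : antipode (q * r) = antipode r * antipode q.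
Proof.
have [[x ->] [y ->]] := conj (hpi_surj q) (hpi_surj r).
rewrite -hpiM [LHS]hantipodeE (primset_anti P) hpiM.
by rewrite -!hantipodeE.
Qed.

Lemma hpi_prim x : primitive x -> primitive (hpi x).
Proof.
move=> xP; rewrite /primitive [LHS]hcomulE xP -[x *t 1]scale1r.
rewrite (tmap_linear hpi_linear hpi_linear) !(tmapE hpi_linear hpi_linear).
by rewrite hpi1 scale1r.
Qed.

End HopfQuotient.

Lemma linD (k : fieldType) (V W : lmodType k) (f : V -> W) :
  linear f -> {morph f : x y / x + y}.
Proof. by move=> fL x y; have := fL 1 x y; rewrite !scale1r. Qed.

Lemma linB (k : fieldType) (V W : lmodType k) (f : V -> W) :
  linear f -> {morph f : x y / x - y}.
Proof.
by move=> fL x y; have := fL (-1) y x; rewrite !scaleN1r ![- _ + _]addrC.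
Qed.

(* One-letter steps of the verification of the Hopf axioms on the free
   algebra: multiplying on the left by a primitive generator. *)
Section Step.
Variables (k : fieldType) (A : augAlgType k) (g : A).
Let G : tensor A A := g *t 1 + 1 *t g.
Let L (t : tensor A A) : tensor A A := tmap ( *%R g) idfun t + tmap idfun ( *%R g) t.

Let gL : linear ( *%R g).
Proof. by move=> c x y; rewrite mulrDr scalerAr. Qed.
Let iL (V : lmodType k) : linear (@idfun V).
Proof. by []. Qed.
Let LL : linear L.
Proof. by apply: linear_add; apply: tmap_linear. Qed.
Let LE a b : L (a *t b) = (g * a) *t b + a *t (g * b).
Proof. by rewrite /L !tmapE. Qed.

Lemma step_mul t : G * t = L t.
Proof.
move: t; apply: (tensor_eq (f := fun t => G * t)) => //.
- by move=> c x y; rewrite mulrDr scalerAr.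
- by move=> a b; rewrite LE mulrDl !tensM !mul1r.
Qed.

Lemma step_counitl : counit g = 0 -> forall t : tensor A A,
  tlift (fun a b => counit a *: b) (G * t)
    = g * tlift (fun a b => counit a *: b) t.
Proof.
move=> g0 t; rewrite step_mul; have B := counitl_bilin A; have BL := tlift_linear B.
move: t; apply: (tensor_eq (f := fun t => tlift _ (L t)) (g := fun t => g * tlift _ t)).
- exact: (linearcomp LL BL).
- exact: (linearcomp BL gL).
move=> a b; rewrite LE (linD BL) !(tliftE B).
by rewrite counitM g0 mul0r scale0r add0r scalerAr.
Qed.

Lemma step_counitr : counit g = 0 -> forall t : tensor A A,
  tlift (fun a b => counit b *: a) (G * t)
    = g * tlift (fun a b => counit b *: a) t.
Proof.
move=> g0 t; rewrite step_mul; have B := counitr_bilin A; have BL := tlift_linear B.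
move: t; apply: (tensor_eq (f := fun t => tlift _ (L t)) (g := fun t => g * tlift _ t)).
- exact: (linearcomp LL BL).
- exact: (linearcomp BL gL).
move=> a b; rewrite LE (linD BL) !(tliftE B).
by rewrite counitM g0 mul0r scale0r addr0 scalerAr.
Qed.

Section StepAntipode.
Variables (S : A -> A) (SL : linear S) (Sg : forall a, S (g * a) = - (S a * g)).

Lemma step_antipodel t : tlift (fun a b => S a * b) (G * t) = 0.
Proof.
rewrite step_mul; have B := mull_bilin SL; have BL := tlift_linear B.
move: t; apply: (tensor_eq (f := fun t => tlift _ (L t)) (g := fun t => 0)).
- exact: (linearcomp LL BL).
- by move=> c x y; rewrite scaler0 addr0.
move=> a b; rewrite LE (linD BL) !(tliftE B).
by rewrite Sg mulNr mulrA addNr.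
Qed.

Lemma step_antipoder t : tlift (fun a b => a * S b) (G * t)
  = g * tlift (fun a b => a * S b) t - tlift (fun a b => a * S b) t * g.
Proof.
rewrite step_mul; have B := mulr_bilin SL; have BL := tlift_linear B.
move: t; apply: (tensor_eq (f := fun t => tlift _ (L t))
  (g := fun t => g * tlift _ t - tlift _ t * g)).
- exact: (linearcomp LL BL).
- apply: linear_add; first exact: (linearcomp BL gL).
  by move=> c x y; rewrite BL mulrDl opprD scalerN scalerAl.
move=> a b; rewrite LE (linD BL) !(tliftE B).
by rewrite Sg mulrN !mulrA.
Qed.
End StepAntipode.

Section StepComul.
Variables (d : A -> tensor A A) (dL : linear d).
Hypothesis dg : forall a, d (g * a) = G * d a.

Let dg' a : d (g * a) = L (d a).
Proof. by rewrite dg step_mul. Qed.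

Lemma step_comulA t : tassoc (tmap d idfun t) = tmap idfun d t ->
  tassoc (tmap d idfun (G * t)) = tmap idfun d (G * t).
Proof.
move=> IH; rewrite step_mul.
pose M (s : tensor A (tensor A A)) := tmap ( *%R g) idfun s + tmap idfun L s.
have ML : linear M by apply: linear_add; apply: tmap_linear.
have diL := tmap_linear dL (@iL A); have idL := tmap_linear (@iL A) dL.
have aL : linear (@tassoc k A A A) := @tassoc_linear _ _ _ _.
have E1 s : tmap idfun d (L s) = M (tmap idfun d s).
  move: s; apply: (tensor_eq (f := fun s => tmap idfun d (L s))
                             (g := fun s => M (tmap idfun d s))).
  - exact: (linearcomp LL idL).
  - exact: (linearcomp idL ML).
  move=> a b; rewrite LE (linD idL) !(tmapE (@iL _) dL) /=.
  by rewrite /M (tmapE gL (@iL _)) (tmapE (@iL _) LL) dg'.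
rewrite E1 -IH.
move: t {IH}; apply: (tensor_eq (f := fun t => tassoc (tmap d idfun (L t)))
                           (g := fun t => M (tassoc (tmap d idfun t)))).
- exact: (linearcomp (linearcomp LL diL) aL).
- exact: (linearcomp (linearcomp diL aL) ML).
move=> a b; rewrite LE (linD diL) !(tmapE dL (@iL _)) /= dg'.
have XL c := @tens_linl k (tensor A A) A c.
move: (d a); apply: (tensor_eq
    (f := fun s => tassoc (L s *t b + s *t (g * b)))
    (g := fun s => M (tassoc (s *t b)))).
- exact: (linearcomp (linear_add (linearcomp LL (XL _)) (XL _)) aL).
- exact: (linearcomp (linearcomp (XL _) aL) ML).
move=> a' b'; rewrite LE (linD (XL b)) !(linD aL) !tassocE /M.
rewrite (tmapE gL (@iL _)) (tmapE (@iL _) LL) LE /= -addrA.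
by rewrite (linD (tens_linr a')).
Qed.
End StepComul.

Lemma step_swap t : tswap t = t -> tswap (G * t) = G * t.
Proof.
have sL := @tswap_linear k A A.
move=> tC; rewrite tswapM tC; congr (_ * _).
by rewrite /G (linD sL) !tswapE addrC.
Qed.

End Step.

(* The Hopf axioms for an algebra whose elements are reached from 1 by linear
   combinations and left multiplication by primitive generators. *)
Section Generated.
Variables (k : fieldType) (A : augAlgType k) (X : Type) (gen : X -> A).
Hypothesis ind : forall P : A -> Prop,
  (forall c u v, P u -> P v -> P (c *: u + v)) -> P 1 ->
  (forall x u, P u -> P (gen x * u)) -> forall u, P u.
Hypothesis gen0 : forall x, counit (gen x) = 0.
Variables (d : A -> tensor A A) (dL : linear d).
Hypothesis d1 : d 1 = 1.
Hypothesis dg : forall x u, d (gen x * u) = (gen x *t 1 + 1 *t gen x) * d u.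

Lemma generated_comulA u : tassoc (tmap d idfun (d u)) = tmap idfun d (d u).
Proof.
have iL : linear (@idfun A) by [].
have diL := tmap_linear dL iL; have idL := tmap_linear iL dL.
have aL : linear (@tassoc k A A A) := @tassoc_linear _ _ _ _.
elim/ind: u => [c u v Hu Hv||x u IH].
- by rewrite dL diL idL aL Hu Hv.
- by rewrite d1 -tens1 !tmapE // d1 -tens1 tassocE.
by rewrite dg; apply: step_comulA => //; apply: dg.
Qed.

Lemma generated_counitl u : tlift (fun a b => counit a *: b) (d u) = u.
Proof.
have B := counitl_bilin A; have BL := tlift_linear B.
elim/ind: u => [c u v Hu Hv||x u IH].
- by rewrite dL BL Hu Hv.
- by rewrite d1 -tens1 (tliftE B) counit1 scale1r.
by rewrite dg step_counitl // IH.
Qed.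

Lemma generated_counitr u : tlift (fun a b => counit b *: a) (d u) = u.
Proof.
have B := counitr_bilin A; have BL := tlift_linear B.
elim/ind: u => [c u v Hu Hv||x u IH].
- by rewrite dL BL Hu Hv.
- by rewrite d1 -tens1 (tliftE B) counit1 scale1r.
by rewrite dg step_counitr // IH.
Qed.

Lemma generated_comulC u : tswap (d u) = d u.
Proof.
have sL := @tswap_linear k A A.
elim/ind: u => [c u v Hu Hv||x u IH].
- by rewrite dL sL Hu Hv.
- by rewrite d1 -tens1 tswapE.
by rewrite dg step_swap.
Qed.

Variables (S : A -> A) (SL : linear S).
Hypothesis S1 : S 1 = 1.
Hypothesis Sg : forall x u, S (gen x * u) = - (S u * gen x).

Lemma generated_antipodel u : tlift (fun a b => S a * b) (d u) = counit u *: 1.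
Proof.
have B := mull_bilin SL; have BL := tlift_linear B.
elim/ind: u => [c u v Hu Hv||x u IH].
- by rewrite dL BL Hu Hv counit_linear scalerDl scalerA.
- by rewrite d1 -tens1 (tliftE B) counit1 scale1r S1 mulr1.
by rewrite dg (step_antipodel SL (Sg x)) counitM gen0 mul0r scale0r.
Qed.

Lemma generated_antipoder u : tlift (fun a b => a * S b) (d u) = counit u *: 1.
Proof.
have B := mulr_bilin SL; have BL := tlift_linear B.
elim/ind: u => [c u v Hu Hv||x u IH].
- by rewrite dL BL Hu Hv counit_linear scalerDl scalerA.
- by rewrite d1 -tens1 (tliftE B) counit1 scale1r S1 mulr1.
rewrite dg (step_antipoder SL (Sg x)) IH -scalerAr -scalerAl mulr1 mul1r subrr.
by rewrite counitM gen0 mul0r scale0r.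
Qed.
End Generated.

Definition freealg (k : fieldType) (X : choiceType) : Type :=
  {malg k[fmonom X]}.
HB.instance Definition _ (k : fieldType) (X : choiceType) :=
  GRing.Lalgebra.on (freealg k X).

Lemma antimorphM_bilin (k : fieldType) (A B : algType k) (f : A -> B) :
  linear f -> bilin (fun x y => f y * f x).
Proof.
move=> fL; split=> [x|x] c y z.
- by rewrite fL mulrDr -scalerAr.
- by rewrite fL mulrDl -scalerAl.
Qed.

Section FreeAlgebra.
Variables (k : fieldType) (X : choiceType).
Local Notation F := (freealg k X).

Definition gen (x : X) : F := << fmu x >>.

Lemma malgUM (v w : fmonom X) : << v >> * << w >> = << mmul v w >> :> F.
Proof. by rewrite [LHS]fgmulUU mulr1. Qed.

Fact fscaleAr (c : k) (u v : {malg k[fmonom X]}) :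
  c *: (u * v) = u * (c *: v).
Proof.
apply/malgP=> m; rewrite mcoeffZ (mcoeffMl u v).
rewrite (mcoeffMlw m (fsubset_refl _) (msuppZ_le c v)) mulr_sumr.
apply: eq_bigr => i _; rewrite mulr_sumr; apply: eq_bigr => j _.
by rewrite mcoeffZ mulrnAr mulrCA.
Qed.
HB.instance Definition _ := GRing.Lalgebra_isAlgebra.Build k (freealg k X)
  fscaleAr.

Lemma freealg_ind (P : F -> Prop) :
  (forall c u v, P u -> P v -> P (c *: u + v)) -> P 1 ->
  (forall x u, P u -> P (gen x * u)) -> forall u, P u.
Proof.
move=> PD P1 PM; elim/malg_ind => [|c u v|[s]].
- by rewrite -(addNr 1) -scaleN1r; apply: PD.
- exact: PD.
elim: s => [|x s IH]; first by have := P1; rewrite /1%R /= /fgone /mone /= fmoneE.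
have -> : << FMonom (x :: s) >> = gen x * << FMonom s >> :> F.
  by rewrite /gen malgUM /mmul /= fmmulE fmU.
exact: PM.
Qed.

Lemma freealg_eq2 (W : lmodType k) (f g : F -> F -> W) :
  bilin f -> bilin g ->
  (forall v w : fmonom X, f << v >> << w >> = g << v >> << w >>) ->
  forall u v, f u v = g u v.
Proof.
move=> [fl fr] [gl gr] fg u v.
elim/malg_ind: u => [|c x y Hx Hy|w].
- by rewrite (lin0 (fl v)) (lin0 (gl v)).
- by have := fl v c x y; have := gl v c x y; rewrite /= => -> ->; rewrite Hx Hy.
elim/malg_ind: v => [|c x y Hx Hy|w']; last exact: fg.
- by rewrite (lin0 (fr _)) (lin0 (gr _)).
- have := fr << w >> c x y; have := gr << w >> c x y.
  by rewrite /= => -> ->; rewrite Hx Hy.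
Qed.

Section WordLift.
Variables (B : algType k) (h : X -> B).
Definition wlift (u : F) : B :=
  mlift (fun w : fmonom X => \prod_(x <- (w : seq X)) h x) u.

Lemma wlift_linear : linear wlift.
Proof. exact: mlift_linear. Qed.
Lemma wlift1 : wlift 1 = 1.
Proof. by rewrite /wlift mliftU fm1 big_nil. Qed.
Lemma wlift_gen x : wlift (gen x) = h x.
Proof. by rewrite /wlift mliftU fmU big_seq1. Qed.
Lemma wliftM u v : wlift (u * v) = wlift u * wlift v.
Proof.
have [B1 B2] := morphM_bilin wlift_linear.
move: u v; apply: (freealg_eq2 B1 B2) => v w.
by rewrite malgUM /wlift !mliftU fmM big_cat.
Qed.
End WordLift.

Definition fcounit (u : F) : k := @mcoeff (fmonom X) k (@mone (fmonom X)) u.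
Fact fcounit_linear : linear_for *%R fcounit.
Proof. by move=> c u v; rewrite /fcounit mcoeffD mcoeffZ. Qed.
Fact fcounit1 : fcounit 1 = 1.
Proof. exact: (rmorph1 (@mcoeff (fmonom X) k (@mone (fmonom X)))). Qed.
Fact fcounitM u v : fcounit (u * v) = fcounit u * fcounit v.
Proof.
exact: (rmorphM (@mcoeff (fmonom X) k (@mone (fmonom X)))). Qed.
HB.instance Definition _ := isAugmented.Build k (freealg k X)
  fcounit_linear fcounit1 fcounitM.

Lemma fcounit_gen x : counit (gen x) = 0.
Proof. by rewrite /counit /= /fcounit mcoeffU1 fm1_eq1. Qed.

Definition fcomul : F -> tensor F F := wlift (fun x => gen x *t 1 + 1 *t gen x).

Lemma fcomul_gen x u :
  fcomul (gen x * u) = (gen x *t 1 + 1 *t gen x) * fcomul u.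
Proof. by rewrite /fcomul wliftM wlift_gen. Qed.

Fact fcomul_linear : linear fcomul.
Proof. exact: wlift_linear. Qed.

Definition fantipode (u : F) : F :=
  mlift (fun w : fmonom X => \prod_(x <- rev w) - gen x) u.
Fact fantipode_linear : linear fantipode.
Proof. exact: mlift_linear. Qed.
Lemma fantipodeM u v : fantipode (u * v) = fantipode v * fantipode u.
Proof.
have [B1 _] := morphM_bilin fantipode_linear.
have B2 : bilin (fun u v : F => fantipode v * fantipode u).
  exact: antimorphM_bilin fantipode_linear.
move: u v; apply: (freealg_eq2 B1 B2) => v w.
by rewrite malgUM /fantipode !mliftU fmM rev_cat big_cat.
Qed.
Lemma fantipode_gen x u : fantipode (gen x * u) = - (fantipode u * gen x).
Proof.
rewrite fantipodeM -mulrN; congr (_ * _).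
by rewrite /fantipode mliftU fmU big_seq1.
Qed.
Lemma fantipode1 : fantipode 1 = 1.
Proof. by rewrite /fantipode mliftU fm1 big_nil. Qed.

Fact fcomul1 : fcomul 1 = 1.
Proof. exact: wlift1. Qed.
Fact fcomulM u v : fcomul (u * v) = fcomul u * fcomul v.
Proof. exact: wliftM. Qed.

Fact fcomulA u :
  tassoc (tmap fcomul idfun (fcomul u)) = tmap idfun fcomul (fcomul u).
Proof. exact: (generated_comulA freealg_ind fcomul_linear fcomul1 fcomul_gen). Qed.
Fact fcomul_counitl u : tlift (fun a b => counit a *: b) (fcomul u) = u.
Proof.
exact: (generated_counitl freealg_ind fcounit_gen fcomul_linear fcomul1 fcomul_gen).
Qed.
Fact fcomul_counitr u : tlift (fun a b => counit b *: a) (fcomul u) = u.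
Proof.
exact: (generated_counitr freealg_ind fcounit_gen fcomul_linear fcomul1 fcomul_gen).
Qed.
Fact fantipodel u :
  tlift (fun a b => fantipode a * b) (fcomul u) = counit u *: 1.
Proof.
exact: (generated_antipodel freealg_ind fcounit_gen fcomul_linear fcomul1
  fcomul_gen fantipode_linear fantipode1 fantipode_gen).
Qed.
Fact fantipoder u :
  tlift (fun a b => a * fantipode b) (fcomul u) = counit u *: 1.
Proof.
exact: (generated_antipoder freealg_ind fcounit_gen fcomul_linear fcomul1
  fcomul_gen fantipode_linear fantipode1 fantipode_gen).
Qed.

HB.instance Definition _ := isHopf.Build k (freealg k X)
  fcomul_linear fcomul1 fcomulM fcomulA fcomul_counitl fcomul_counitr
  fantipode_linear fantipodel fantipoder.

Fact fcomulC (u : F) : tswap (comul u) = comul u.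
Proof. exact: (generated_comulC freealg_ind fcomul_linear fcomul1 fcomul_gen). Qed.
HB.instance Definition _ := isCocommutative.Build k (freealg k X) fcomulC.

Lemma gen_prim x : primitive (gen x).
Proof. exact: wlift_gen. Qed.

End FreeAlgebra.

Lemma zmod_cancel (V : zmodType) (a b c d e f : V) :
  - (a + b + (c + d)) + (e + c + (b + f)) = - a + e + (- d + f).
Proof.
rewrite !opprD !addrA [LHS](ACl (1*5*(4*8)*(2*7)*(3*6)))/= !addNr !addr0.
by rewrite !addrA.
Qed.

Section Primitive.
Variables (k : fieldType) (H : hopfAlgType k).
Implicit Types (x y z : H).

Lemma prim_lin (c : k) x y : primitive x -> primitive y -> primitive (c *: x + y).
Proof.
move=> xP yP; rewrite /primitive comul_linear xP yP.
by rewrite (tens_linl _ c) (tens_linr _ c) scalerDr addrACA.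
Qed.

Lemma primB x y : primitive x -> primitive y -> primitive (x - y).
Proof. by move=> xP yP; rewrite -scaleN1r addrC; apply: prim_lin. Qed.

Lemma prim_comm x y : primitive x -> primitive y -> primitive (x * y - y * x).
Proof.
move=> xP yP; rewrite /primitive -scaleN1r addrC comul_linear !comulM xP yP.
rewrite (tens_linl _ (-1)) (tens_linr _ (-1)) !scaleN1r.
rewrite !mulrDl !mulrDr !tensM !mul1r !mulr1.
exact: zmod_cancel.
Qed.

Lemma prim_exp (p : nat) z : p \in [pchar k] -> primitive z -> primitive (z ^+ p).
Proof.
move=> kp zP; have Tp : p \in [pchar (tensor H H)] by rewrite pchar_lalg.
have comulX n : comul (z ^+ n) = comul z ^+ n.
  by elim: n => [|n IH]; rewrite ?expr0 ?comul1 // !exprS comulM IH.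
have X1 n : (z *t 1 : tensor H H) ^+ n = z ^+ n *t 1.
  by elim: n => [|n IH]; rewrite ?expr0 ?tens1 // !exprS IH tensM mulr1.
have X2 n : (1 *t z : tensor H H) ^+ n = 1 *t z ^+ n.
  by elim: n => [|n IH]; rewrite ?expr0 ?tens1 // !exprS IH tensM mulr1.
have cz : GRing.comm (z *t 1 : tensor H H) (1 *t z).
  by rewrite /GRing.comm !tensM !mul1r !mulr1.
rewrite /primitive comulX zP -!(pFrobenius_autE Tp).
by rewrite (pFrobenius_autD_comm Tp cz) !pFrobenius_autE X1 X2.
Qed.
End Primitive.

HB.mixin Record isLie (k : fieldType) g of GRing.Lmodule k g := {
  lie : g -> g -> g;
  lie_bilin : bilin lie;
  liexx : forall x, lie x x = 0;
  jacobi : forall x y z,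
    lie x (lie y z) + lie y (lie z x) + lie z (lie x y) = 0
}.
#[short(type="lieAlgType")]
HB.structure Definition LieAlgebra (k : fieldType) :=
  {g of GRing.Lmodule k g & isLie k g}.

Section Lie.
Variables (k : fieldType) (g : lieAlgType k).

Definition lie_rota_baxter (lam : k) (R : g -> g) : Prop :=
  linear R /\
  forall x y, lie (R x) (R y)
    = R (lie (R x) y) + R (lie x (R y)) + lam *: R (lie x y).

(* k[t] (x) g is encoded by sequences of coefficients in g: the sequence c
   stands for the sum of the t^j (x) c j, and ad_tx_y x y is ad_{tx+y}. *)
Definition ad_tx_y (x y : g) (c : nat -> g) : nat -> g := fun j =>
  (if j is i.+1 then lie x (c i) else 0) + lie y (c j).

Definition jacobson_s (p : nat) (x y : g) (i : nat) : g :=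
  i%:R^-1 *: iter p.-1 (ad_tx_y x y) (fun j => if j == 0%N then x else 0) i.-1.

Definition is_p_map (p : nat) (pmap : g -> g) : Prop :=
  [/\ forall (a : k) x, pmap (a *: x) = a ^+ p *: pmap x,
      forall x y, lie (pmap x) y = iter p (lie x) y &
      forall x y, pmap (x + y)
        = pmap x + pmap y + \sum_(1 <= i < p) jacobson_s p x y i].

Definition rb_pow (R : g -> g) (x : g) (n : nat) : g :=
  iter n.-1 (fun y => lie (R x) y) x.

(* [a1, [a2, ... [a(r-1), ar] ...]] *)
Fixpoint nested_lie (s : seq g) : g :=
  match s with
  | [::] => 0
  | [:: a] => a
  | a :: s' => lie a (nested_lie s')
  end.

Definition comp_coef (alpha : seq nat) : nat :=
  (\prod_(j < size alpha)
    'C((sumn (take j.+1 alpha)).-1, (nth 0 alpha j).-1))%N.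

Definition is_composition (n : nat) (alpha : seq nat) : bool :=
  all (fun a => 0 < a)%N alpha && (sumn alpha == n).

(* The parts of a composition of p are at most p, so the compositions of p of
   length r are tuples over 'I_p.+1. *)
Definition rb_pmap (p : nat) (lam : k) (pmap R : g -> g) (x : g) : g :=
  lam ^+ p.-1 *: pmap x +
  \sum_(1 <= r < p) (r%:R^-1 * lam ^+ r.-1) *:
    \sum_(t : r.-tuple 'I_p.+1 | is_composition p (map val t))
      let alpha : seq nat := map val t in
      (comp_coef alpha)%:R *: nested_lie (map (rb_pow R x) alpha).

Definition restricted_rota_baxter (p : nat) (lam : k) (pmap R : g -> g) : Prop :=
  [/\ is_p_map p pmap, lie_rota_baxter lam R &
      forall x, R (rb_pmap p lam pmap R x) = pmap (R x)].

End Lie.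

Section HopfMaps.
Variables (k : fieldType).

(* For a trilinear f, the sum of the f x_1 x_2 x_3 in Sweedler notation. *)
Definition sweedler3 (H : hopfAlgType k) (V : lmodType k)
    (f : H -> H -> H -> V) (x : H) : V :=
  tlift (fun t c => tlift (fun a b => f a b c) t) (tmap comul idfun (comul x)).

Definition coalgebra_endo (H : hopfAlgType k) (f : H -> H) : Prop :=
  [/\ linear f, forall x, comul (f x) = tmap f f (comul x) &
      forall x, counit (f x) = counit x].

Definition hopf_endo (H : hopfAlgType k) (f : H -> H) : Prop :=
  [/\ coalgebra_endo f, f 1 = 1, forall x y, f (x * y) = f x * f y &
      forall x, f (antipode x) = antipode (f x)].

Definition hopf_rota_baxter (H : cocommHopfAlgType k) (R : H -> H) : Prop :=
  coalgebra_endo R /\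
  forall x y,
    R x * R y = R (sweedler3 (fun a b c => a * R b * y * antipode (R c)) x).

End HopfMaps.

Inductive uea_rel (k : fieldType) (g : lieAlgType k) : freealg k g -> Prop :=
| uea_rel_lin (c : k) (x y : g) :
    uea_rel (gen k (c *: x + y) - (c *: gen k x + gen k y))
| uea_rel_lie (x y : g) :
    uea_rel (gen k x * gen k y - gen k y * gen k x - gen k (lie x y)).

Lemma morph_comm_kills (k : fieldType) (A B : algType k) (W : A -> B) (x y z : A) :
  linear W -> (forall u v, W (u * v) = W u * W v) ->
  W z = W x * W y - W y * W x -> W (x * y - y * x - z) = 0.
Proof. by move=> WL WM Wz; rewrite !(linB WL) !WM Wz subrr. Qed.

Lemma morph_kernel_ideal (k : fieldType) (A B : algType k) (W : A -> B) (a x : A) :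
  (forall u v, W (u * v) = W u * W v) ->
  W x = 0 -> W (a * x) = 0 /\ W (x * a) = 0.
Proof. by move=> WM Wx; rewrite !WM Wx mul0r mulr0. Qed.

Section UEA.
Variables (k : fieldType) (g : lieAlgType k).

Fact uea_rel_prim (z : freealg k g) : uea_rel z -> primitive z.
Proof.
case=> [c x y|x y]; apply: primB; try exact: gen_prim.
- by apply: prim_lin; apply: gen_prim.
- by apply: prim_comm; apply: gen_prim.
Qed.

Definition uea_rels : primset (freealg k g) :=
  PrimSet uea_rel_prim (@fantipodeM k g).

(* The free algebra on the set g modulo the linear relations is the tensor
   algebra of g. *)
Definition UEA : Type := hquot uea_rels.
HB.instance Definition _ := CocommHopfAlgebra.on UEA.

Definition uea_in (x : g) : UEA := hpi uea_rels (gen k x).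

Lemma uea_in_linear : linear uea_in.
Proof.
move=> c x y; rewrite -hpi_linear; apply/hpi_eq/ideal_gen.
exact: uea_rel_lin.
Qed.

Lemma uea_in_lie x y :
  uea_in x * uea_in y - uea_in y * uea_in x = uea_in (lie x y).
Proof.
rewrite -!hpiM -hpiB; apply/hpi_eq/ideal_gen; exact: uea_rel_lie.
Qed.

Lemma uea_in_prim x : primitive (uea_in x).
Proof. exact/hpi_prim/gen_prim. Qed.

Lemma uea_ind (P : UEA -> Prop) :
  (forall c u v, P u -> P v -> P (c *: u + v)) -> P 1 ->
  (forall x u, P u -> P (uea_in x * u)) -> forall u, P u.
Proof.
move=> PD P1 PM u; have [w ->] := hpi_surj u.
elim/freealg_ind: w => [c v w Pv Pw||x w Pw] //.
- by rewrite hpi_linear; apply: PD.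
- by rewrite hpiM; apply: PM.
Qed.

Lemma uea_lift (B : algType k) (f : g -> B) :
  linear f -> (forall x y, f (lie x y) = f x * f y - f y * f x) ->
  exists F : UEA -> B,
    [/\ linear F, F 1 = 1, forall u v, F (u * v) = F u * F v &
        forall x, F (uea_in x) = f x].
Proof.
move=> fL fB; pose W := wlift f; have WL : linear W by apply: wlift_linear.
have WM u v : W (u * v) = W u * W v by apply: wliftM.
have Wg x : W (gen k x) = f x by apply: wlift_gen.
have W0 w : ideal (@uea_rel k g) w -> W w = 0.
  apply: ideal_kernel => // [_ [c x y|x y]|a z z0].
  - by rewrite (linB WL) WL !Wg fL subrr.
  - by apply: morph_comm_kills => //; rewrite !Wg fB.
  - exact: morph_kernel_ideal.
pose F (u : UEA) := W (vrepr u).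
have FE w : F (hpi uea_rels w) = W w.
  apply/eqP; rewrite -subr_eq0 -(linB WL); apply/eqP/W0.
  exact: (vrepr_pi (ideal uea_rels)).
exists F; split.
- move=> c u v; have [[x ->] [y ->]] := conj (hpi_surj u) (hpi_surj v).
  by rewrite -hpi_linear !FE WL.
- by rewrite -(hpi1 uea_rels) FE /W wlift1.
- move=> u v; have [[x ->] [y ->]] := conj (hpi_surj u) (hpi_surj v).
  by rewrite -hpiM !FE WM.
- by move=> x; rewrite /uea_in FE Wg.
Qed.

(* By Goncharov's theorem there is exactly one such RU when R is a Rota-Baxter
   operator of weight 1 on g. *)
Definition uea_extension (R : g -> g) (RU : UEA -> UEA) : Prop :=
  [/\ hopf_rota_baxter RU,
      forall x, RU (uea_in x) = uea_in (R x),
      RU 1 = 1 &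
      forall x y, RU (uea_in x * y) = RU (uea_in x) * RU y
        - RU (uea_in (R x) * y - y * uea_in (R x))].

End UEA.

Definition ruea_rel (k : fieldType) (p : nat) (g : lieAlgType k)
    (pmap : g -> g) (z : UEA g) : Prop :=
  exists x : g, z = uea_in x ^+ p - uea_in (pmap x).

Section RestrictedUEA.
Variables (k : fieldType) (p : nat) (kp : p \in [pchar k]).
Variables (g : lieAlgType k) (pmap : g -> g).

Fact ruea_rel_prim (z : UEA g) : ruea_rel p pmap z -> primitive z.
Proof.
case=> x ->; apply: primB; last exact: uea_in_prim.
by apply: prim_exp => //; apply: uea_in_prim.
Qed.

Definition ruea_rels : primset (UEA g) :=
  PrimSet ruea_rel_prim (@hantiM _ _ (uea_rels g)).

Definition RUEA : Type := hquot ruea_rels.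
HB.instance Definition _ := CocommHopfAlgebra.on RUEA.

Definition ruea_pi (u : UEA g) : RUEA := hpi ruea_rels u.

End RestrictedUEA.

(* Main.v *)
Require Import Defs.
From HB Require Import structures.
From mathcomp Require Import all_boot all_order all_algebra.

Set Implicit Arguments.
Unset Strict Implicit.
Unset Printing Implicit Defensive.

Import GRing.Theory.
Local Open Scope ring_scope.

(** Jacobson's formula writes (x + d)^p - x^p - d^p in U(g) as the sum of the
    s_r(x, d), where r s_r(x, d) is the coefficient of t^(r-1) in
    ad_{tx+d}^(p-1)(x). Expanding ad_{tx+d}^(p-1)(x) by the Leibniz rule gives
    exactly the sum of the C_alpha [x_{alpha_1}, [..., x_{alpha_r}]] with
    x_n = ad_d^(n-1)(x); for d = R x this reads
    x^{[p]_R} = x^[p] + sum_r s_r(x, R x). On the other hand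
    RU(x u + [R x, u]) = RU(x) RU(u), and the p-th iterate of
    u |-> x u + [R x, u] = (x + R x) u - u (R x) sends 1 to
    (x + R x)^p - (R x)^p. Comparing the two,
    RU(x^p - x^[p]) = (R x)^p - (R x)^[p]. The elements z = x^p - x^[p] are
    primitive and central, so that RU(z u) = RU(z) RU(u), and they span the
    defining ideal of u(g) as a left U(g)-module; hence RU preserves it.

    If R is idempotent and p <> 2, the Rota-Baxter identity forces
    [R x, R y] = 0 = R [x, y], so R extends to an algebra endomorphism of U(g)
    satisfying the recursion of RU, and both coincide by induction on the length
    of words. *)

Lemma pascal_sum (V : nmodType) n (F : nat -> V) :
  \sum_(b < n.+1) F b *+ 'C(n, b) + \sum_(b < n.+1) F b.+1 *+ 'C(n, b)
  = \sum_(b < n.+2) F b *+ 'C(n.+1, b).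
Proof.
rewrite big_ord_recl [X in _ + X = _]big_ord_recr [RHS]big_ord_recl /= !bin0.
rewrite -!addrA; congr (_ + _); rewrite [RHS]big_ord_recr /= !binn addrA.
congr (_ + _); rewrite -big_split /=; apply: eq_bigr => b _.
by rewrite /bump add1n binS mulrnDr.
Qed.

Section CharP.
Variables (S : nzRingType) (p : nat) (Sp : p \in [pchar S]).
Implicit Types a b u : S.

Lemma iter_commutator a b u n :
  iter n (fun v => a * v - v * b) u =
  \sum_(j < n.+1) ((-1) ^+ j * (a ^+ (n - j) * u * b ^+ j)) *+ 'C(n, j).
Proof.
elim: n => [|n IH].
  by rewrite big_ord1 bin0 !expr0 !mulr1 !mul1r.
rewrite iterS IH mulr_sumr mulr_suml -sumrB.
pose F j := (-1) ^+ j * (a ^+ (n.+1 - j) * u * b ^+ j).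
rewrite -(pascal_sum n F) -big_split /=; apply: eq_bigr => j _.
rewrite mulrnAr mulrnAl -mulrnBl -mulrnDl; congr (_ *+ _).
rewrite /F subSn ?leq_ord // subSS.
have C : GRing.comm a ((-1) ^+ j) by apply/commrX/commrN1.
rewrite (mulrA a) C -!mulrA -exprSr [a ^+ _.+1]exprS [(-1) ^+ _.+1]exprS.
by rewrite mulN1r mulNr !mulrA.
Qed.

Lemma sign_bin_pred_pchar j : (j < p)%N -> (-1) ^+ j * 'C(p.-1, j)%:R = 1 :> S.
Proof.
have pp := pcharf_prime Sp; have p0 := prime_gt0 pp.
elim: j => [|j IH] lt_jp; first by rewrite bin0 mulr1.
have E : 'C(p.-1, j)%:R = - 'C(p.-1, j.+1)%:R :> S.
  apply/eqP; rewrite -addr_eq0 -natrD addnC -binS prednK //.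
  by rewrite -(dvdn_pcharf Sp) prime_dvd_bin.
by rewrite exprS mulN1r mulNr -mulrN -E IH // ltnW.
Qed.

Lemma iter_commutator_pred_pchar a b u :
  iter p.-1 (fun v => a * v - v * b) u =
  \sum_(i < p) a ^+ (p.-1 - i) * u * b ^+ i.
Proof.
have p0 := prime_gt0 (pcharf_prime Sp).
rewrite iter_commutator prednK //; apply: eq_bigr => j _.
by rewrite -mulrnAl -mulr_natr sign_bin_pred_pchar // mul1r.
Qed.

Lemma iter_commutator_pchar a b u :
  iter p (fun v => a * v - v * b) u = a ^+ p * u - u * b ^+ p.
Proof.
have p0 := prime_gt0 (pcharf_prime Sp).
rewrite -[in LHS](prednK p0) iterS iter_commutator_pred_pchar.
rewrite -(prednK p0) /= mulr_sumr mulr_suml big_ord_recl [X in _ - X]big_ord_recr /=.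
rewrite subn0 subnn !expr0 mulr1 mul1r -!mulrA -exprSr !mulrA -exprS.
have -> : \sum_(i < p.-1) a * (a ^+ (p.-1 - bump 0 i) * u * b ^+ bump 0 i)
        = \sum_(i < p.-1) a ^+ (p.-1 - i) * u * b ^+ i * b.
  apply: eq_bigr => i _; rewrite !mulrA -exprS /bump add1n -[RHS]mulrA -exprSr.
  by rewrite -subSn // subSS.
by rewrite opprD addrA addrK.
Qed.

End CharP.

Lemma comm_sub_commutator (S : nzRingType) (a b c : S) :
  a * c - c * a = b * c - c * b -> GRing.comm (a - b) c.
Proof.
move=> E; have {}E : a * c = b * c - c * b + c * a by rewrite -E subrK.
by rewrite /GRing.comm mulrBl mulrBr E addrAC (addrAC (b * c)) subrr add0r addrC.
Qed.

Lemma linear_eq_lin (k : fieldType) (V W : lmodType k) (f h : V -> W) (c : k)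
    (u v : V) :
  linear f -> linear h -> f u = h u -> f v = h v -> f (c *: u + v) = h (c *: u + v).
Proof. by move=> fL hL Eu Ev; rewrite fL hL Eu Ev. Qed.

Lemma commutator_mulr (S : nzRingType) (a b c d : S) : a * b - b * a = d ->
  a * (b * c) - b * c * a = d * c + b * (a * c - c * a).
Proof. by move=> <-; rewrite mulrBl mulrBr !mulrA addrA subrK. Qed.

Lemma commr_lin (k : fieldType) (A : algType k) (a u v : A) (c : k) :
  GRing.comm a u -> GRing.comm a v -> GRing.comm a (c *: u + v).
Proof.
by move=> Cu Cv; rewrite /GRing.comm mulrDr mulrDl -scalerAr -scalerAl Cu Cv.
Qed.

Lemma morph_commutator (k : fieldType) (A B : algType k) (f : A -> B) (a b : A) :
  linear f -> (forall u v, f (u * v) = f u * f v) -> GRing.comm (f a) (f b) ->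
  f (a * b - b * a) = 0.
Proof. by move=> fL fM C; rewrite (linB fL) !fM C subrr. Qed.

Lemma antimorph_comm (S : nzRingType) (f s : S -> S) (a b : S) :
  (forall u v, f (u * v) = f u * f v) -> (forall u v, s (u * v) = s v * s u) ->
  f (s a) = s (f a) -> f (s b) = s (f b) -> f (s (a * b)) = s (f (a * b)).
Proof. by move=> fM sM Ea Eb; rewrite sM !fM sM Ea Eb. Qed.

Section Jacobson.
Variables (S : nzRingType) (p : nat) (Sp : p \in [pchar S]) (x y : S).
Let a : {poly S} := x%:P * 'X + y%:P.

Let a' : a^`() = x%:P.
Proof. by rewrite derivMXaddC derivC mul0r addr0. Qed.

Let coef_commutator (u : {poly S}) r :
  (a * u - u * a)`_r =
  (if r is r'.+1 then x * u`_r' - u`_r' * x else 0) + (y * u`_r - u`_r * y).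
Proof.
rewrite /a mulrDl mulrDr -mulrA -commr_polyX !mulrA coefB !coefD !coefMX.
rewrite !coefCM !coefMC; case: r => [|r] /=; first by rewrite !add0r.
by rewrite opprD addrACA.
Qed.

Let deriv_exp_a n : (a ^+ n)^`() = \sum_(i < n) a ^+ (n.-1 - i) * x%:P * a ^+ i.
Proof.
elim: n => [|n IH]; first by rewrite expr0 -polyC1 derivC big_ord0.
rewrite exprS derivM a' IH big_ord_recr /= subnn expr0 mul1r addrC; congr (_ + _).
rewrite mulr_sumr; apply: eq_bigr => i _; rewrite !mulrA -exprS.
by rewrite -predn_sub prednK // subn_gt0.
Qed.

Let coef_exp_a n : (size (a ^+ n) <= n.+1)%N /\ (a ^+ n)`_n = x ^+ n.
Proof.
elim: n => [|n [IHs IHc]]; first by rewrite !expr0 size_poly1 coef1.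
rewrite !exprS /a mulrDl -mulrA -commr_polyX mulrA; split.
  apply: leq_trans (size_polyD _ _) _; rewrite geq_max; apply/andP; split.
    apply: leq_trans (size_polyMleq _ _) _; rewrite size_polyX addn2 /= ltnS.
    apply: leq_trans (size_polyMleq _ _) _.
    have := size_polyC_leq1 x; case: (size _) => [|[|//]] _;
      by rewrite ?add0n ?add1n //= (leq_trans (leq_pred _)).
  apply: leq_trans (size_polyMleq _ _) _.
  have := size_polyC_leq1 y; case: (size _) => [|[|//]] _;
    by rewrite ?add0n ?add1n /= (leq_trans _ (leqW IHs)) ?leq_pred.
by rewrite coefD coefMX /= !coefCM IHc [X in _ + y * X]nth_default ?mulr0 ?addr0.
Qed.

Lemma expr_addr_pchar (c : nat -> nat -> S) :
  (forall r, c 0%N r = if r == 0%N then x else 0) ->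
  (forall n r, c n.+1 r = (if r is r'.+1 then x * c n r' - c n r' * x else 0)
                        + (y * c n r - c n r * y)) ->
  exists q : nat -> S,
    (x + y) ^+ p = x ^+ p + y ^+ p + \sum_(1 <= r < p) q r /\
    (forall r, (0 < r)%N -> (q r) *+ r = c p.-1 r.-1).
Proof.
move=> c0 cS; have pp := pcharf_prime Sp; have p0 := prime_gt0 pp.
have Pp : p \in [pchar {poly S}] by rewrite pchar_poly.
have cE n r : (iter n (fun v => a * v - v * a) x%:P)`_r = c n r.
  elim: n r => [|n IH] r; first by rewrite c0 coefC.
  by rewrite iterS coef_commutator cS !IH; case: r => [|r]; rewrite ?IH.
exists (fun r => (a ^+ p)`_r); split; last first.
  case=> // r _; rewrite -coef_deriv deriv_exp_a.
  by rewrite -(iter_commutator_pred_pchar Pp) cE.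
have c1 : comm_poly a 1 by rewrite /comm_poly mulr1 mul1r.
have -> : x + y = a.[1] by rewrite hornerD hornerC hornerMX hornerC mulr1.
rewrite -horner_exp_comm // (horner_coef_wide _ (coef_exp_a p).1).
under eq_bigr do rewrite expr1n mulr1.
rewrite big_ord_recr /= (coef_exp_a p).2.
rewrite -(big_mkord xpredT (fun i => (a ^+ p)`_i)) /=.
rewrite big_ltn // addrC -addrA; congr (_ + (_ + _)).
rewrite -horner_coef0 horner_exp_comm; last by rewrite /comm_poly mulr0 mul0r.
by rewrite hornerD hornerC hornerMX mulr0 add0r.
Qed.

End Jacobson.

Lemma lin_sum (k : fieldType) (V W : lmodType k) (f : V -> W) (I : Type)
    (s : seq I) (P : pred I) (F : I -> V) :
  linear f -> f (\sum_(i <- s | P i) F i) = \sum_(i <- s | P i) f (F i).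
Proof. by move=> fL; apply: big_morph; [apply: linD|apply: lin0]. Qed.

Lemma linZ (k : fieldType) (V W : lmodType k) (f : V -> W) :
  linear f -> scalable f.
Proof. by move=> fL a v; rewrite -[a *: v]addr0 fL (lin0 fL) addr0. Qed.

Lemma linMn (k : fieldType) (V W : lmodType k) (f : V -> W) :
  linear f -> forall n, {morph f : v / v *+ n}.
Proof. by move=> fL n v /=; rewrite -!scaler_nat (linZ fL). Qed.

Lemma is_composition_rcons m s b :
  is_composition m (rcons s b) =
  [&& 0 < b, b <= m & is_composition (m - b) s]%N.
Proof.
rewrite /is_composition all_rcons sumn_rcons -!andbA; congr (_ && _).
rewrite andbCA; congr (_ && _); apply/eqP/andP => [<-|[le_bm /eqP->]].
  by rewrite leq_addl addnK.
exact: subnK.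
Qed.

Lemma comp_coef_rcons s b :
  comp_coef (rcons s b) = (comp_coef s * 'C((sumn s + b).-1, b.-1))%N.
Proof.
rewrite /comp_coef size_rcons big_ord_recr /= nth_rcons ltnn eqxx.
rewrite -(size_rcons s b) take_size sumn_rcons; congr (_ * _)%N.
apply: eq_bigr => j _; rewrite nth_rcons ltn_ord -cats1 take_cat.
case: ltnP => // lt; have -> : j.+1 = size s by apply/eqP; rewrite eqn_leq lt andbT.
by rewrite subnn take0 cats0 take_size.
Qed.

Lemma big_composition_rcons (V : zmodType) (q r m : nat) (F : seq nat -> V) :
  (m <= q)%N ->
  \sum_(t : r.+1.-tuple 'I_q.+1 | is_composition m (map val t)) F (map val t) =
  \sum_(b < m) \sum_(t : r.-tuple 'I_q.+1
                       | is_composition (m - b.+1) (map val t))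
    F (rcons (map val t) b.+1).
Proof.
move=> le_mq.
pose h (u : 'I_q.+1 * r.-tuple 'I_q.+1) : r.+1.-tuple 'I_q.+1 :=
  [tuple of rcons u.2 u.1].
have h_bij : bijective h.
  apply: inj_card_bij; last by rewrite card_prod !card_tuple card_ord expnS.
  by move=> [b t] [b' t'] /(congr1 val)/= /rcons_inj[/val_inj-> ->].
rewrite (reindex h) /=; last exact: onW_bij.
rewrite (eq_bigl (fun u : 'I_q.+1 * r.-tuple 'I_q.+1 =>
  (0 < u.1 <= m)%N && is_composition (m - u.1) (map val u.2))); last first.
  by move=> u; rewrite map_rcons is_composition_rcons andbA.
rewrite -(pair_big_dep (fun b : 'I_q.+1 => (0 < b <= m)%N)
  (fun b (t : r.-tuple 'I_q.+1) => is_composition (m - b) (map val t))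
  (fun b t => F (map val (rcons t b)))) /=.
rewrite big_mkcond big_ord_recl /= add0r -big_mkcond /= (big_ord_narrow le_mq) /=.
by apply: eq_bigr => b _; apply: eq_bigr => t _; rewrite map_rcons.
Qed.

Section LieWords.
Variables (k : fieldType) (g : lieAlgType k).
Implicit Types (x y d : g).

Lemma lie_linl x : linear (lie^~ x).
Proof. exact: (lie_bilin (s := g)).1. Qed.
Lemma lie_linr x : linear (lie x).
Proof. exact: (lie_bilin (s := g)).2. Qed.

Lemma lieC x y : lie x y = - lie y x.
Proof.
have := liexx (x + y); rewrite (linD (lie_linl _)) !(linD (lie_linr _)) !liexx.
by rewrite add0r addr0 => /eqP; rewrite addr_eq0 => /eqP.
Qed.

Lemma lie_leibniz d x y : lie d (lie x y) = lie (lie d x) y + lie x (lie d y).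
Proof.
have /eqP := jacobi d x y; rewrite -addrA addr_eq0 => /eqP ->.
have lieN z : lie x (- z) = - lie x z.
  by rewrite -scaleN1r (linZ (lie_linr x)) scaleN1r.
by rewrite opprD addrC -lieC (lieC y d) lieN opprK.
Qed.

Lemma nested_lie_rcons (s : seq g) x :
  nested_lie (rcons s x) = foldr lie x s.
Proof. by elim: s => //= y [|z s] //= ->. Qed.

Section Words.
Variables (x d : g).
Let X n := iter n.-1 (lie d) x.

(* The sum of C_alpha ad_{X alpha_1} ... ad_{X alpha_r} y over the compositions
   alpha of m of length r, by recursion on the last part of alpha. *)
Fixpoint comp_ad (r m : nat) (y : g) : g :=
  if r is r'.+1 then
    \sum_(b < m) comp_ad r' (m.-1 - b)%N (lie (X b.+1) y) *+ 'C(m.-1, b)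
  else if m == 0%N then y else 0.

Lemma comp_ad_linear r m : linear (comp_ad r m).
Proof.
elim: r m => [|r IH] m c y z /=.
  by case: ifP => // _; rewrite scaler0 addr0.
rewrite scaler_sumr -big_split /=; apply: eq_bigr => b _.
by rewrite lie_linr IH mulrnDl scalerMnr.
Qed.

Lemma lie_comp_ad r m y :
  lie d (comp_ad r m y) + (if r is r'.+1 then lie x (comp_ad r' m y) else 0) =
  comp_ad r m.+1 y + comp_ad r m (lie d y).
Proof.
elim: r m y => [|r IH] m y.
  by rewrite /= addr0 add0r; case: eqP => // _; rewrite (lin0 (lie_linr d)).
have Wl0 := lin0 (lie_linr _).
case: m => [|m].
  rewrite /= !big_ord0 big_ord1 Wl0 add0r addr0 bin0 mulr1n /=.
  by case: r {IH} => [|r] //=; rewrite !big_ord0 Wl0.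
have -> : lie x (comp_ad r m.+1 y) = \sum_(b < m.+1)
    (if r is r'.+1 then lie x (comp_ad r' (m - b) (lie (X b.+1) y)) else 0)
      *+ 'C(m, b).
  case: r {IH} => [|r].
    by rewrite /= Wl0 big1 // => b _; rewrite mul0rn.
  rewrite [comp_ad _ _ _]/= (lin_sum _ _ _ (lie_linr x)).
  by apply: eq_bigr => b _; rewrite (linMn (lie_linr x)).
rewrite [comp_ad r.+1 m.+1 y]/= (lin_sum _ _ _ (lie_linr d)) -big_split /=.
under eq_bigr => b _.
  rewrite (linMn (lie_linr d)) -mulrnDl IH lie_leibniz (linD (comp_ad_linear _ _)).
  rewrite -subSn ?leq_ord // addrA 2!mulrnDl.
  over.
rewrite 2!big_split /= -(pascal_sum m (fun b => comp_ad r (m.+1 - b) (lie (X b.+1) y))).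
by [].
Qed.

Lemma iter_ad_tx_y n r :
  iter n (ad_tx_y x d) (fun j => if j == 0%N then x else 0) r =
  \sum_(b < n.+1) comp_ad r (n - b) (X b.+1) *+ 'C(n, b).
Proof.
elim: n r => [|n IH] r.
  by rewrite big_ord1 bin0 mulr1n /=; case: r => [|r] //=; rewrite big_ord0.
rewrite iterS /ad_tx_y addrC; have -> : (if r is i.+1 then
    lie x (iter n (ad_tx_y x d) (fun j => if j == 0%N then x else 0) i) else 0)
  = \sum_(b < n.+1)
      (if r is i.+1 then lie x (comp_ad i (n - b) (X b.+1)) else 0) *+ 'C(n, b).
  case: r => [|r]; first by rewrite big1 // => b _; rewrite mul0rn.
  rewrite IH (lin_sum _ _ _ (lie_linr x)); apply: eq_bigr => b _.
  by rewrite (linMn (lie_linr x)).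
rewrite IH (lin_sum _ _ _ (lie_linr d)) -big_split /=.
under eq_bigr => b _.
  rewrite (linMn (lie_linr d)) -mulrnDl lie_comp_ad.
  rewrite -subSn ?leq_ord // mulrnDl.
  over.
by rewrite big_split /= -(pascal_sum n (fun b => comp_ad r (n.+1 - b) (X b.+1))).
Qed.

Lemma comp_adE q r m y : (m <= q)%N ->
  \sum_(t : r.-tuple 'I_q.+1 | is_composition m (map val t))
    (comp_coef (map val t))%:R *: foldr lie y (map X (map val t)) =
  comp_ad r m y.
Proof.
elim: r m y => [|r IH] m y le_mq.
  rewrite big_mkcond (big_pred1 [tuple]) => [|t]; last by rewrite [t]tuple0 [RHS]eqxx.
  rewrite /is_composition /= /comp_coef big_ord0 scale1r eq_sym.
  by case: m {le_mq}.
rewrite (big_composition_rcons _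
  (fun s => (comp_coef s)%:R *: foldr lie y (map X s))) //=.
apply: eq_bigr => b _; have lt_bm := ltn_ord b.
rewrite -IH; last by rewrite (leq_trans (leq_subr _ _)) // (leq_trans (leq_pred _)).
rewrite -sumrMnl -subn1 -subnDA add1n; apply: eq_bigr => t /andP[_ /eqP St].
by rewrite comp_coef_rcons map_rcons foldr_rcons St subnK // subn1 !scaler_nat mulrnA.
Qed.

Lemma iter_ad_tx_y_compositions q n r : (n < q)%N ->
  iter n (ad_tx_y x d) (fun j => if j == 0%N then x else 0) r =
  \sum_(t : r.+1.-tuple 'I_q.+1 | is_composition n.+1 (map val t))
    (comp_coef (map val t))%:R *: nested_lie (map X (map val t)).
Proof.
move=> lt_nq; rewrite iter_ad_tx_y.
rewrite (big_composition_rcons _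
  (fun s => (comp_coef s)%:R *: nested_lie (map X s))) //.
apply: eq_bigr => b _; rewrite -(@comp_adE q); last first.
  by rewrite (leq_trans (leq_subr _ _)) // ltnW.
rewrite -sumrMnl subSS; apply: eq_bigr => t /andP[_ /eqP St].
rewrite comp_coef_rcons map_rcons nested_lie_rcons St addnS subnK ?leq_ord //.
by rewrite !scaler_nat mulrnA.
Qed.

End Words.

Lemma rb_pmap1 p (pmap R : g -> g) x : (0 < p)%N ->
  rb_pmap p 1 pmap R x = pmap x + \sum_(1 <= r < p) jacobson_s p x (R x) r.
Proof.
move=> p0; rewrite /rb_pmap expr1n scale1r; congr (_ + _).
rewrite !big_nat; apply: eq_bigr => -[//|r] /andP[_ lt_rp].
rewrite expr1n mulr1 /jacobson_s (@iter_ad_tx_y_compositions _ _ p) ?ltn_predL //.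
by rewrite /= (prednK p0).
Qed.
End LieWords.

(* Below, GRing identities are applied to UEA g as complete terms: when a rewrite
   pattern fails to match there, unification unfolds the quotient construction
   and does not return in reasonable time. *)
Section Enveloping.
Variables (k : fieldType) (p : nat) (kp : p \in [pchar k]) (g : lieAlgType k).
Implicit Types (x y : g).

Let Up : p \in [pchar (UEA g)]. Proof. by rewrite pchar_lalg. Qed.

Lemma uea_in_jacobson x y :
  uea_in (x + y) ^+ p =
  uea_in x ^+ p + uea_in y ^+ p + uea_in (\sum_(1 <= r < p) jacobson_s p x y r).
Proof.
have IL := @uea_in_linear k g.
pose K n r := iter n (ad_tx_y x y) (fun j => if j == 0%N then x else 0) r.
have [|n r|q [qE qK]] := @expr_addr_pchar _ p Up (uea_in x) (uea_in y)
    (fun n r => uea_in (K n r)).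
- by move=> r; rewrite /K /=; case: eqP => // _; rewrite (lin0 IL).
- rewrite /K iterS [X in uea_in X]/ad_tx_y (linD IL); congr (_ + _).
    case: r => [|r]; first exact: lin0 IL.
    exact/esym/uea_in_lie.
  exact/esym/uea_in_lie.
rewrite (linD IL) qE (lin_sum _ _ _ IL); congr (_ + _).
rewrite !big_nat; apply: eq_bigr => r /andP[r0 lt_rp].
have nz : r%:R != 0 :> k by rewrite -(dvdn_pcharf kp) gtnNdvd.
by rewrite /jacobson_s (linZ IL) -qK // -scaler_nat scalerA mulVf // scale1r.
Qed.

Lemma uea_in_comm (z u : UEA g) :
  (forall y, GRing.comm z (uea_in y)) -> GRing.comm z u.
Proof.
move=> zE; elim/uea_ind: u => [c u v Hu Hv||y u IH].
- exact (commr_lin c Hu Hv).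
- exact (commr1 z).
- exact (commrM (zE y) IH).
Qed.

Lemma uea_in_pmap_central (pmap : g -> g) x u :
  is_p_map p pmap ->
  GRing.comm (uea_in x ^+ p - uea_in (pmap x)) u.
Proof.
move=> [_ adp _]; apply: uea_in_comm => y.
have E : iter p (fun v => uea_in x * v - v * uea_in x) (uea_in y)
       = uea_in (iter p (lie x) y).
  by elim: p => //= n ->; rewrite uea_in_lie.
have E1 : uea_in x ^+ p * uea_in y - uea_in y * uea_in x ^+ p
        = uea_in (lie (pmap x) y).
  by rewrite adp -E; exact (esym (iter_commutator_pchar Up _ _ _)).
exact (comm_sub_commutator (etrans E1 (esym (uea_in_lie _ _)))).
Qed.

Section Extension.
Variables (R : g -> g) (RU : UEA g -> UEA g) (hRU : uea_extension R RU).

(* x * u = x u + [R x, u] is the product of the descendent Hopf algebra, for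
   which RU is multiplicative; in characteristic p the p-th power of
   u |-> x * u is computed from the commuting multiplications by x + R x on the
   left and R x on the right. *)
Lemma extension_expr_pchar x :
  RU ((uea_in x + uea_in (R x)) ^+ p - uea_in (R x) ^+ p) = uea_in (R x) ^+ p.
Proof.
have [[[RL _ _] _] RI R1 RM] := hRU.
have E n : RU (iter n (fun u => (uea_in x + uea_in (R x)) * u - u * uea_in (R x)) 1)
         = uea_in (R x) ^+ n.
  elim: n => //= n IH; rewrite mulrDl -addrA (linD RL) RM IH RI -exprS.
  by rewrite addrNK.
by rewrite -[RHS]E (iter_commutator_pchar Up) mulr1 mul1r.
Qed.

Lemma extension_pmap (pmap : g -> g) x :
  restricted_rota_baxter p 1 pmap R ->
  RU (uea_in x ^+ p - uea_in (pmap x)) =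
  uea_in (R x) ^+ p - uea_in (pmap (R x)).
Proof.
move=> [_ _ Rp]; have [[[RL _ _] _] RI _ _] := hRU.
have p0 := prime_gt0 (pcharf_prime kp).
rewrite -Rp (rb_pmap1 _ _ _ p0) -[in RHS](extension_expr_pchar x) -(RI (_ + _)).
have IL := @uea_in_linear k g.
rewrite -(linB RL) -(linD IL) uea_in_jacobson (linD IL); congr RU.
by rewrite [X in X - uea_in (R x) ^+ p]addrAC addrK opprD addrACA subrr addr0.
Qed.

End Extension.
End Enveloping.

Section Sweedler.
Variables (k : fieldType).

Definition trilin (A B C V : lmodType k) (f : A -> B -> C -> V) :=
  [/\ forall b c, linear (fun a => f a b c), forall a c, linear (fun b => f a b c)
    & forall a b, linear (f a b)].

Lemma trilin_bilin (A B C V : lmodType k) (f : A -> B -> C -> V) :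
  trilin f -> bilin (fun t c => tlift (fun a b => f a b c) t).
Proof.
move=> [f1 f2 f3]; have fB c : bilin (fun a b => f a b c) by [].
split=> [c|t] d x y; first by rewrite (tlift_linear (fB c)).
elim/tensor_ind: t => [e t u IHt IHu|a b].
  rewrite !(tlift_linear (fB _) e) IHt IHu; exact: linswap.
by rewrite !(tliftE (fB _)) f3.
Qed.

Lemma sweedler3_prim (H : hopfAlgType k) (V : lmodType k)
    (f : H -> H -> H -> V) (z : H) :
  trilin f -> primitive z -> sweedler3 f z = f z 1 1 + f 1 z 1 + f 1 1 z.
Proof.
move=> fT zP; have fB := trilin_bilin fT; have fL := tlift_linear fB.
have fB1 c : bilin (fun a b => f a b c) by case: fT.
have iL : linear (@idfun H) by [].
have dL := @comul_linear k H; have diL := tmap_linear dL iL.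
rewrite /sweedler3 zP (linD diL) !(tmapE dL iL) /=.
rewrite comul1 -tens1 zP (linD fL) !(tliftE fB).
by rewrite (linD (tlift_linear (fB1 1))) !(tliftE (fB1 _)).
Qed.

Lemma sweedler3_nat (H H' : hopfAlgType k) (V V' : lmodType k) (h : H -> H')
    (v : V -> V') (f : H -> H -> H -> V) (f' : H' -> H' -> H' -> V') (x : H) :
  linear h -> linear v -> trilin f -> trilin f' ->
  (forall x, comul (h x) = tmap h h (comul x)) ->
  (forall a b c, v (f a b c) = f' (h a) (h b) (h c)) ->
  v (sweedler3 f x) = sweedler3 f' (h x).
Proof.
move=> hL vL fT fT' hD vf; rewrite /sweedler3 hD.
have fB := trilin_bilin fT; have fL := tlift_linear fB.
have fB' := trilin_bilin fT'; have fL' := tlift_linear fB'.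
have fB1 c : bilin (fun a b => f a b c) by case: fT.
have fB1' c : bilin (fun a b => f' a b c) by case: fT'.
have iL (A : lmodType k) : linear (@idfun A) by [].
have dL := @comul_linear k H; have dL' := @comul_linear k H'.
have hhL := tmap_linear hL hL.
have -> : tmap comul idfun (tmap h h (comul x)) =
    tmap (tmap h h) h (tmap comul idfun (comul x)).
  rewrite (tmap_comp hL hL dL' (iL _) (f'' := fun a => comul (h a)) (g'' := h)) //.
  by rewrite (tmap_comp dL (iL _) hhL hL (f'' := fun a => comul (h a)) (g'' := h)).
move: (tmap comul idfun _) => t.
apply: (tensor_eq (f := fun t => v (tlift _ t))
  (g := fun t => tlift _ (tmap (tmap h h) h t))).
- exact: linearcomp fL vL.
- exact: linearcomp (tmap_linear hhL hL) fL'.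
move=> s c; rewrite tmapE // (tliftE fB) (tliftE fB').
apply: (tensor_eq (f := fun s => v (tlift _ s))
  (g := fun s => tlift _ (tmap h h s))).
- exact: linearcomp (tlift_linear (fB1 _)) vL.
- exact: linearcomp hhL (tlift_linear (fB1' _)).
by move=> a b; rewrite tmapE // (tliftE (fB1 _)) (tliftE (fB1' _)).
Qed.

Lemma rota_baxter_trilin (H : hopfAlgType k) (R : H -> H) (y : H) :
  linear R -> trilin (fun a b c => a * R b * y * antipode (R c)).
Proof.
move=> RL; split=> [b c|a c|a b] d u v /=.
- by rewrite !mulrDl -!scalerAl.
- by rewrite RL mulrDr !mulrDl -scalerAr -!scalerAl.
- by rewrite RL antipode_linear mulrDr -scalerAr.
Qed.

Lemma rota_baxter_prim (H : cocommHopfAlgType k) (R : H -> H) (z y : H) :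
  hopf_rota_baxter R -> R 1 = 1 -> primitive z -> primitive (R z) ->
  R z * R y = R (z * y + R z * y - y * R z).
Proof.
move=> [[RL _ _] RB] R1 zP RzP; rewrite RB; congr R.
rewrite (sweedler3_prim (rota_baxter_trilin y RL) zP).
by rewrite R1 antipode1 !mulr1 !mul1r (prim_antipode RzP) mulrN.
Qed.

End Sweedler.

Lemma ideal_central_span (k : fieldType) (A : algType k) (P : A -> Prop) (w : A) :
  (forall z a, P z -> a * z = z * a) ->
  ideal P w -> Defs.span (fun v => exists z u, P z /\ v = z * u) w.
Proof.
move=> PC; set N := fun v => _; apply; last first.
  by move=> z Pz; apply: span_gen; exists z, 1; rewrite mulr1.
move=> a v Nv; split; apply/vpi_eq0.
- apply: (@span_kernel _ _ _ N (fun v => vpi (Defs.span N) (a * v))) => //.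
    by move=> c x y; rewrite mulrDr -scalerAr linearP.
  move=> _ [z [u [Pz ->]]]; apply/vpi_eq0/span_gen; exists z, (a * u).
  by rewrite !mulrA (PC z).
- apply: (@span_kernel _ _ _ N (fun v => vpi (Defs.span N) (v * a))) => //.
    by move=> c x y; rewrite mulrDl -scalerAl linearP.
  move=> _ [z [u [Pz ->]]]; apply/vpi_eq0/span_gen; exists z, (u * a).
  by rewrite mulrA.
Qed.

Lemma primset_rota_baxter_ideal (k : fieldType) (H : cocommHopfAlgType k)
    (P : primset H) (R : H -> H) :
  hopf_rota_baxter R -> R 1 = 1 ->
  (forall z a, P z -> a * z = z * a) -> (forall z, P z -> P (R z)) ->
  forall w, ideal P w -> ideal P (R w).
Proof.
move=> RH R1 PC PR w /(ideal_central_span PC) Sw; have [[RL _ _] _] := RH.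
apply/hpi_eq0; move: w Sw.
apply: (span_kernel (f := fun w => hpi P (R w))).
  by move=> c x y; rewrite RL hpi_linear.
move=> _ [z [u [Pz ->]]]; apply/hpi_eq0.
have := rota_baxter_prim u RH R1 (primset_prim Pz) (primset_prim (PR _ Pz)).
rewrite (PC (R z) u (PR _ Pz)) addrK => <-.
exact: (ideal_ideal _ (ideal_gen (PR _ Pz))).2.
Qed.

Section Descent.
Variables (k : fieldType) (H : cocommHopfAlgType k) (P : primset H) (R : H -> H).
Hypotheses (RH : hopf_rota_baxter R) (RP : forall w, ideal P w -> ideal P (R w)).

Definition hquot_map (q : hquot P) : hquot P := hpi P (R (vrepr q)).

Lemma hquot_mapE x : hquot_map (hpi P x) = hpi P (R x).
Proof.
have [[RL _ _] _] := RH; apply/hpi_eq; rewrite -(linB RL).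
exact/RP/(vrepr_pi (ideal P)).
Qed.

Lemma hquot_map_rota_baxter : hopf_rota_baxter hquot_map.
Proof.
have [[RL RD Re] RB] := RH; have piL := hpi_linear P.
have QL : linear hquot_map.
  move=> c q r; have [[x ->] [y ->]] := conj (hpi_surj q) (hpi_surj r).
  by rewrite -hpi_linear !hquot_mapE RL hpi_linear.
have DE x : comul (hpi P x) = tmap (hpi P) (hpi P) (comul x) by apply: hcomulE.
split; first split=> //.
- move=> q; have [x ->] := hpi_surj q; rewrite hquot_mapE !DE RD.
  rewrite (tmap_comp RL RL piL piL (f'' := fun a => hpi P (R a))
    (g'' := fun a => hpi P (R a))) //.
  rewrite (tmap_comp piL piL QL QL (f'' := fun a => hpi P (R a))
    (g'' := fun a => hpi P (R a))) // => a; exact: hquot_mapE.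
- move=> q; have [x ->] := hpi_surj q; rewrite hquot_mapE.
  by rewrite [LHS]hcounitE [RHS]hcounitE Re.
move=> q r; have [[x ->] [y ->]] := conj (hpi_surj q) (hpi_surj r).
rewrite !hquot_mapE -hpiM RB -hquot_mapE; congr hquot_map.
apply: sweedler3_nat => //; try exact: rota_baxter_trilin.
by move=> a b c; rewrite !hquot_mapE [antipode _ in RHS]hantipodeE !hpiM.
Qed.

Lemma hquot_map_hopf_endo : R 1 = 1 -> (forall x y, R (x * y) = R x * R y) ->
  (forall x, R (antipode x) = antipode (R x)) -> hopf_endo hquot_map.
Proof.
move=> R1 RM RS; have [QC _] := hquot_map_rota_baxter; split=> //.
- by rewrite -hpi1 hquot_mapE R1.
- move=> q r; have [[x ->] [y ->]] := conj (hpi_surj q) (hpi_surj r).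
  by rewrite -hpiM !hquot_mapE RM hpiM.
- move=> q; have [x ->] := hpi_surj q.
  have SE u : antipode (hpi P u) = hpi P (antipode u) by apply: hantipodeE.
  by rewrite SE !hquot_mapE SE RS.
Qed.

End Descent.

Section Idempotent.
Variables (k : fieldType) (g : lieAlgType k) (R : g -> g).
Hypotheses (RB : lie_rota_baxter 1 R) (RR : forall x, R (R x) = R x).
Hypothesis two_neq0 : 2%:R != 0 :> k.

Let RL : linear R. Proof. by case: RB. Qed.

Let double_eq0 (V : lmodType k) (v : V) : v + v = 0 -> v = 0.
Proof.
by move=> /eqP; rewrite -mulr2n -scaler_nat scaler_eq0 (negPf two_neq0) => /eqP.
Qed.

Lemma idempotent_lie_image x y : lie (R x) (R y) = 0.
Proof.
have E := RB.2 (R x) (R y); rewrite !RR scale1r in E.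
have : R (lie (R x) (R y)) + R (lie (R x) (R y)) = 0.
  have := congr1 R E; rewrite !(linD RL) !RR => /eqP.
  by rewrite -addrA -subr_eq0 opprD addrA subrr sub0r oppr_eq0 => /eqP.
by move=> /double_eq0 R0; rewrite E R0 !addr0.
Qed.

Lemma idempotent_lie_l x y : R (lie (R x) y) = 0.
Proof.
have := RB.2 (R x) y; rewrite RR idempotent_lie_image (lin0 RL) addr0 scale1r.
by move=> /esym/double_eq0.
Qed.

Lemma idempotent_lie x y : R (lie x y) = 0.
Proof.
have := RB.2 x y; rewrite idempotent_lie_image idempotent_lie_l scale1r lieC.
rewrite -scaleN1r (linZ RL) idempotent_lie_l scaler0 !add0r.
by move=> /esym.
Qed.

Variables (RU : UEA g -> UEA g) (hRU : uea_extension R RU).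

Let word (s : seq g) : UEA g := \prod_(x <- s) uea_in x.
Let words n (u : UEA g) : Prop := exists2 s, size s = n & u = word s.

Let word_cons x s : word (x :: s) = uea_in x * word s.
Proof. exact: big_cons. Qed.

Lemma span_words_commutator y s :
  Defs.span (words (size s)) (uea_in y * word s - word s * uea_in y).
Proof.
elim: s => [|x s IH].
  by rewrite /word big_nil mulr1 mul1r subrr; apply: subsp0.
rewrite word_cons.
have -> := commutator_mulr (word s) (uea_in_lie y x).
apply: subspD.
  by apply: span_gen; exists (lie y x :: s); rewrite ?word_cons.
apply/vpi_eq0; move: IH.
apply: (span_kernel (f := fun v => vpi (Defs.span (words (size s).+1)) (uea_in x * v))).
  by move=> c u v; rewrite mulrDr -scalerAr linearP.
move=> _ [t <- ->]; apply/vpi_eq0/span_gen.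
by exists (x :: t); rewrite ?word_cons.
Qed.

Lemma span_all_words u : Defs.span (fun u => exists s, u = word s) u.
Proof.
elim/uea_ind: u => [c u v||x u IH]; first exact: subspP.
- by apply: span_gen; exists [::]; rewrite /word big_nil.
set N := fun u => _ in IH *.
apply/vpi_eq0; move: IH.
apply: (span_kernel (f := fun v => vpi (Defs.span N) (uea_in x * v))).
  by move=> c v w; rewrite mulrDr -scalerAr linearP.
move=> _ [t ->]; apply/vpi_eq0/span_gen; exists (x :: t).
by rewrite word_cons.
Qed.

Lemma idempotent_extension_morph :
  (forall u v, RU (u * v) = RU u * RU v) /\
  (forall u, RU (antipode u) = antipode (RU u)).
Proof.
have IL := @uea_in_linear k g; have [[[RUL _ _] _] RI R1 RM] := hRU.
have [||F [FL F1 FM FI]] := @uea_lift k g (UEA g) (fun x => uea_in (R x)).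
- by move=> c x y; rewrite RL IL.
- by move=> x y; rewrite uea_in_lie idempotent_lie idempotent_lie_image (lin0 IL).
have FC x u : F (uea_in (R x) * u - u * uea_in (R x)) = 0.
  have C : GRing.comm (F (uea_in (R x))) (F u).
    rewrite FI RR.
    elim/uea_ind: u => [c u v Hu Hv||y u IH].
    - by rewrite FL; exact (commr_lin c Hu Hv).
    - by rewrite F1; exact (commr1 _).
    have Cy : GRing.comm (uea_in (R x)) (uea_in (R y)).
      apply/eqP; rewrite -subr_eq0 uea_in_lie idempotent_lie_image.
      by rewrite (lin0 IL).
    by rewrite FM FI; exact (commrM Cy IH).
  exact (morph_commutator FL FM C).
have EL : linear (fun u => RU u - F u).
  by move=> c u v; rewrite RUL FL opprD addrACA scalerBr.
have words_eq s : RU (word s) = F (word s).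
  have [n] := ubnP (size s); elim: n s => // n IH [|x s] /= le_sn.
    by rewrite /word big_nil R1 F1.
  have E : RU (uea_in (R x) * word s - word s * uea_in (R x)) = 0.
    rewrite -[RHS](FC x (word s)); apply/eqP; rewrite -subr_eq0; apply/eqP.
    move: (@span_words_commutator (R x) s); apply: (span_kernel EL) => _ [t st ->].
    by rewrite IH ?subrr // st.
  rewrite word_cons (RM x (word s)) E subr0 (RI x).
  by rewrite (IH s le_sn) (FM (uea_in x)) (FI x).
have RUF u : RU u = F u.
  apply/eqP; rewrite -subr_eq0; apply/eqP.
  move: (@span_all_words u); apply: (span_kernel EL) => _ [s ->].
  by rewrite words_eq subrr.
split=> [u v|u]; first by rewrite !RUF FM.
rewrite !RUF.
have SM : forall u v : UEA g, antipode (u * v) = antipode v * antipode u.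
  exact: (@hantiM _ _ (uea_rels g)).
have SL := @antipode_linear k (UEA g).
elim/uea_ind: u => [c u v Hu Hv||x u IH].
- exact (linear_eq_lin c (linearcomp SL FL) (linearcomp FL SL) Hu Hv).
- by rewrite antipode1 F1 antipode1.
have Sx : F (antipode (uea_in x)) = antipode (F (uea_in x)).
  rewrite FI (prim_antipode (uea_in_prim x)) (prim_antipode (uea_in_prim (R x))).
  by rewrite -scaleN1r (linZ FL) FI scaleN1r.
exact (antimorph_comm FM SM Sx IH).
Qed.

End Idempotent.

Theorem theorem4p18 (k : closedFieldType) (p : nat) (hp : p \in [pchar k])
    (g : lieAlgType k) (pmap R : g -> g)
    (hR : restricted_rota_baxter p 1 pmap R)
    (RU : UEA g -> UEA g) (hRU : uea_extension R RU) :
  exists Ru : RUEA hp pmap -> RUEA hp pmap,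
    [/\ forall u : UEA g, Ru (ruea_pi hp pmap u) = ruea_pi hp pmap (RU u),
        hopf_rota_baxter Ru &
        (forall x : g, R (R x) = R x) -> p <> 2%N -> hopf_endo Ru].
Proof.
have [pP RB _] := hR; have [RUB _ RU1 _] := hRU.
have PC z a : ruea_rels hp pmap z -> a * z = z * a.
  by case=> x ->; exact (esym (uea_in_pmap_central hp x a pP)).
have PR z : ruea_rels hp pmap z -> ruea_rels hp pmap (RU z).
  by case=> x ->; exists (R x); exact (extension_pmap hp hRU x hR).
have RUP := primset_rota_baxter_ideal RUB RU1 PC PR.
exists (@hquot_map _ _ (ruea_rels hp pmap) RU); split.
- by move=> u; apply: hquot_mapE.
- exact: hquot_map_rota_baxter.
move=> RR p2; have two_neq0 : 2%:R != 0 :> k.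
  rewrite -(dvdn_pcharf hp) dvdn_prime2 ?(pcharf_prime hp) //; exact/eqP.
have [RUM RUS] := idempotent_extension_morph RB RR two_neq0 hRU.
exact: hquot_map_hopf_endo.
Qed.
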